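(* Let $n\ge 0$. The essential image of the contravariant functor $\Omega^\bullet\colon \bigl(\widehat{\mathsf{SS}}^{\mathrm{ns}}_{\leq n}\bigr)^{\mathrm{op}}\to \mathsf{DG}_n$, $\widehat S\mapsto \Omega_S^\bullet$, $\widehat g\mapsto g^*$, is precisely $\widehat{\mathsf{DG}}_n$. In particular, $\Omega^\bullet\colon \bigl(\widehat{\mathsf{SS}}^{\mathrm{ns}}_{\leq n}\bigr)^{\mathrm{op}}\to \widehat{\mathsf{DG}}_n$ is an equivalence of categories.
   Context: $\Bbbk$ is a field of characteristic different from $2$. **Non-singular complexes.** $\Delta_n$ is the category of ordered sets $[0],\dots,[n]$ ($[p]=\{0<\dots<p\}$) with order-preserving maps, $\Delta_n^+$ its subcategory of order-preserving injections. An $n$-truncated (semi)simplicial set is a contravariant functor from $\Delta_n$ (resp. $\Delta_n^+$) to sets; $S_p=S([p])$, $d_j$ are the face maps. For $\sigma\in S_p$, $v_i(\sigma)\in S_0$ is the $i$-th vertex and $\operatorname{vert}_p(\sigma)=(v_0(\sigma),\dots,v_p(\sigma))$. $\mathsf{SS}^{\mathrm{ns}}_{\leq n}$ is the full subcategory of $n$-truncated semisimplicial sets $S$ such that: (1) $\bigsqcup_p S_p$ is finite; (2) every $\operatorname{vert}_p\colon S_p\to (S_0)^{p+1}$ is injective; (3) every simplex of positive dimension has pairwise distinct vertices. One writes $\sigma=[v_0,\dots,v_p]$ for the simplex with vertex tuple $(v_0,\dots,v_p)$. **Completion.** $U$ is the forgetful functor from $n$-truncated simplicial to $n$-truncated semisimplicial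 sets, $L$ its left adjoint, $L(S)_p=\coprod_{\pi\colon[p]\twoheadrightarrow[q]}S_q$ (order-preserving surjections), and $\widehat S:=UL(S)$. $\widehat{\mathsf{SS}}^{\mathrm{ns}}_{\leq n}$ is the full subcategory of $n$-truncated semisimplicial sets spanned by the $\widehat S$ with $S\in\mathsf{SS}^{\mathrm{ns}}_{\leq n}$. Every morphism $\widehat g\colon\widehat S\to\widehat T$ in it underlies a unique simplicial map $g\colon L(S)\to L(T)$; its degree-zero part is $g_0\colon S_0\to T_0$. **DGAs.** A DGA is a graded unital associative $\Bbbk$-algebra $\Omega^\bullet=\bigoplus_{p\ge0}\Omega^p$ with product $\wedge$ and a degree $+1$ differential $d$, $d^2=0$, satisfying the graded Leibniz rule; morphisms are unital, degree-preserving algebra maps commuting with $d$. $\mathsf{DG}_n$ is the full subcategory of DGAs concentrated in degrees $0,\dots,n$. A DGA with $A=\Omega^0$ is *exterior* if $\Omega^1$ is spanned by elements $f\,dg$ ($f,g\in A$) and the iterated product $(\Omega^1)^{\otimes_A p}\to\Omega^p$ is surjective for all $p\ge1$. **The functor.** For $S\in\mathsf{SS}^{\mathrm{ns}}_{\leq n}$, $\Omega_S^\bullet$ has $\Omega_S^0=\Bbbk(S_0)$ (functions on $S_0$, with basis $\rho_{[v]}=\delta_v$ of primitive idempotents), $\Omega_S^p=\bigoplus_{\sigma\in S_p}\Bbbk\rho_\sigma$ for $1\le p\le n$, and $\Omega_S^p=0$ for $p>n$. For $\sigma=[v_0,\dots,v_p]$, $\tau=[w_0,\dots,w_q]$: $\rho_\sigma\wedge\rho_\tau=\rho_{[v_0,\dots,v_p,w_1,\dots,w_q]}$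 if $v_p=w_0$ and $(v_0,\dots,v_p,w_1,\dots,w_q)$ is the vertex tuple of a simplex of $S$, and $0$ otherwise. The differential is $d\rho_\sigma=\sum_{j=0}^{p+1}(-1)^j\sum_{\tau\in S_{p+1},\,d_j\tau=\sigma}\rho_\tau$. For $\widehat g\colon\widehat S\to\widehat T$, $g^*\colon\Omega_T^\bullet\to\Omega_S^\bullet$ is $g^*(\rho_{[w_0,\dots,w_p]})=\sum\rho_{[v_0,\dots,v_p]}$, the sum over $[v_0,\dots,v_p]\in S_p$ with $g_0(v_i)=w_i$ for all $i$. **The category $\widehat{\mathsf{DG}}_n$** is the full subcategory of $\mathsf{DG}_n$ on the DGAs $\Omega^\bullet$ satisfying: (D1) There are a finite set $X$ and an algebra isomorphism $\iota\colon\Bbbk(X)\cong\Omega^0$, and $\Omega^\bullet$ is exterior. Write $\delta_x$ for $\iota(\delta_x)$ and $\Omega^p_{x,y}:=\delta_x\Omega^p\delta_y$. (D2) For $p>1$ and $x,y\in X$: $\Omega^p_{x,y}=0$ whenever $\Omega^1_{x,y}=0$. (D3) Put $\omega_{[x,y]}:=\delta_x d(\delta_y)$ if $x\ne y$ and $\omega_{[x,x]}:=0$, and $\overline E_\Omega:=\{(x,y)\in X^2\mid x\neq y,\ \Omega^1_{x,y}\ne0\}$. For $1\le p\le n$ let $P_p(x,y)$ be the set of $(v_0,\dots,v_p)$ with $v_0=x$, $v_p=y$, $(v_i,v_{i+1})\in\overline E_\Omega$ for $0\le i<p$; for $v\in P_p(x,y)$ put $m(v)=\omega_{[v_0,v_1]}\wedge\dots\wedge\omega_{[v_{p-1},v_p]}$,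 and let $S_p(x,y)=\{v\in P_p(x,y)\mid m(v)\neq0\}$. Then for all $x,y\in X$ and $1\le p\le n$ the family $(m(v))_{v\in S_p(x,y)}$ is a $\Bbbk$-basis of $\Omega^p_{x,y}$. *)

(* Defs.v *)
From HB Require Import structures.
From mathcomp Require Import all_boot all_order all_algebra.
From mathcomp Require Import zify ring.
From Stdlib Require Import FunctionalExtensionality ProofIrrelevance.

Set Implicit Arguments.
Unset Strict Implicit.
Unset Printing Implicit Defensive.

Import GRing.Theory.

Record Category := MkCategory {
  Ob :> Type;
  Mor : Ob -> Ob -> Type;
  idm : forall x, Mor x x;
  mcomp : forall x y z, Mor y z -> Mor x y -> Mor x z;
  comp_idl : forall x y (f : Mor x y), mcomp (idm y) f = f;
  comp_idr : forall x y (f : Mor x y), mcomp f (idm x) = f;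
  compA : forall x y z w (h : Mor z w) (g : Mor y z) (f : Mor x y),
    mcomp h (mcomp g f) = mcomp (mcomp h g) f }.

Arguments Mor {c} x y : rename.
Arguments idm {c} x : rename.
Arguments mcomp {c x y z} g f : rename.
Notation "g \oc f" := (mcomp g f) (at level 50, left associativity).

Record Functor (C D : Category) := MkFunctor {
  fob :> C -> D;
  fmap : forall x y, Mor x y -> Mor (fob x) (fob y);
  fmap_id : forall x, fmap (idm x) = idm (fob x);
  fmap_comp : forall x y z (g : Mor y z) (f : Mor x y),
    fmap (g \oc f) = fmap g \oc fmap f }.

Arguments fmap {C D} F {x y} f : rename.

Record NatTrans (C D : Category) (F G : Functor C D) := MkNatTrans {
  ntc :> forall x, Mor (F x) (G x);
  ntc_nat : forall x y (f : Mor x y), ntc y \oc fmap F f = fmap G f \oc ntc x }.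

Definition Op (C : Category) : Category :=
  @MkCategory C (fun x y => Mor y x) (fun x => idm x)
    (fun x y z g f => f \oc g)
    (fun x y f => comp_idr f) (fun x y f => comp_idl f)
    (fun x y z w h g f => esym (compA f g h)).

Definition id_functor (C : Category) : Functor C C :=
  @MkFunctor C C (fun x => x) (fun x y f => f)
    (fun x => erefl) (fun x y z g f => erefl).

Section CompFunctor.
Variables (C D E : Category) (G : Functor D E) (F : Functor C D).

Lemma comp_functor_id x : fmap G (fmap F (idm x)) = idm (G (F x)).
Proof. by rewrite !fmap_id. Qed.

Lemma comp_functor_comp x y z (g : Mor y z) (f : Mor x y) :
  fmap G (fmap F (g \oc f)) = fmap G (fmap F g) \oc fmap G (fmap F f).
Proof. by rewrite !fmap_comp. Qed.

Definition comp_functor : Functor C E :=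
  @MkFunctor C E (fun x => G (F x)) (fun x y f => fmap G (fmap F f))
    comp_functor_id comp_functor_comp.
End CompFunctor.

Section FunctorCategory.
Variables (C D : Category).

Lemma nattrans_eq (F G : Functor C D) (a b : NatTrans F G) :
  (forall x, a x = b x) -> a = b.
Proof.
case: a b => [a na] [b nb] /= ab0.
have ab := functional_extensionality_dep _ _ ab0.
by subst b; rewrite (proof_irrelevance _ na nb).
Qed.

Definition nt_id (F : Functor C D) : NatTrans F F.
Proof.
refine (@MkNatTrans C D F F (fun x => idm (F x)) _).
by move=> x y f; rewrite comp_idl comp_idr.
Defined.

Definition nt_comp (F G H : Functor C D)
  (b : NatTrans G H) (a : NatTrans F G) : NatTrans F H.
Proof.
refine (@MkNatTrans C D F H (fun x => b x \oc a x) _).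
by move=> x y f; rewrite -compA ntc_nat compA ntc_nat -compA.
Defined.

Definition Fun : Category.
Proof.
refine (@MkCategory (Functor C D) (@NatTrans C D) nt_id nt_comp _ _ _).
- by move=> F G a; apply: nattrans_eq => x /=; rewrite comp_idl.
- by move=> F G a; apply: nattrans_eq => x /=; rewrite comp_idr.
- by move=> F G H K c b a; apply: nattrans_eq => x /=; rewrite compA.
Defined.
End FunctorCategory.

(* The full subcategory of [D] spanned by a family of objects [ob]. *)
Definition Full (D : Category) (I : Type) (ob : I -> D) : Category :=
  @MkCategory I (fun i j => Mor (ob i) (ob j)) (fun i => idm (ob i))
    (fun i j l g f => g \oc f)
    (fun i j f => comp_idl f) (fun i j f => comp_idr f)
    (fun i j l m h g f => compA h g f).

Definition FullSub (D : Category) (P : D -> Prop) : Category :=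
  Full (fun x : {x : D | P x} => sval x).

Definition corestrict (C D : Category) (F : Functor C D) (P : D -> Prop)
  (FP : forall x, P (F x)) : Functor C (FullSub P) :=
  @MkFunctor C (FullSub P) (fun x => exist P (F x) (FP x))
    (fun x y f => fmap F f) (fun x => fmap_id F x)
    (fun x y z g f => fmap_comp F g f).

Definition is_iso (C : Category) (x y : C) (f : Mor x y) : Prop :=
  exists g : Mor y x, g \oc f = idm x /\ f \oc g = idm y.

Definition isomorphic (C : Category) (x y : C) : Prop :=
  exists f : Mor x y, is_iso f.

Definition nat_isomorphic (C D : Category) (F G : Functor C D) : Prop :=
  exists a : NatTrans F G, forall x, is_iso (a x).

Definition ess_image (C D : Category) (F : Functor C D) (y : D) : Prop :=
  exists x : C, isomorphic (F x) y.

Definition is_equivalence (C D : Category) (F : Functor C D) : Prop :=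
  exists G : Functor D C,
    nat_isomorphic (comp_functor G F) (id_functor C)
    /\ nat_isomorphic (comp_functor F G) (id_functor D).

Definition SetCat : Category :=
  @MkCategory Type (fun A B => A -> B) (fun A x => x)
    (fun A B C g f x => g (f x))
    (fun A B f => erefl) (fun A B f => erefl)
    (fun A B C D h g f => erefl).

Definition FinSetCat : Category := Full (fun T : finType => (T : Type) : SetCat).

Definition FinSet_incl : Functor FinSetCat SetCat :=
  @MkFunctor FinSetCat SetCat (fun T => T) (fun A B f => f)
    (fun A => erefl) (fun A B C g f => erefl).

(* The ordered set [p] is ['I_p.+1]. *)
Record ordmap (p q : nat) := OrdMap {
  om_fun :> 'I_p.+1 -> 'I_q.+1;
  om_homo : forall i j : 'I_p.+1, i <= j -> om_fun i <= om_fun j }.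

Record ordinj (p q : nat) := OrdInj {
  oi_map :> ordmap p q;
  oi_inj : injective oi_map }.

Record ordsurj (p q : nat) := OrdSurj {
  os_map :> ordmap p q;
  os_surj : forall j, exists i, os_map i = j }.

Lemma ordmap_eq p q (f g : ordmap p q) : f =1 g -> f = g.
Proof.
case: f g => [f hf] [g hg] /= fg0; have fg := functional_extensionality _ _ fg0.
by subst g; rewrite (proof_irrelevance _ hf hg).
Qed.

Lemma ordinj_eq p q (f g : ordinj p q) : f =1 g -> f = g.
Proof.
case: f g => [f hf] [g hg] /= fg0; have fg := ordmap_eq fg0.
by subst g; rewrite (proof_irrelevance _ hf hg).
Qed.

Lemma ordsurj_eq p q (f g : ordsurj p q) : f =1 g -> f = g.
Proof.
case: f g => [f hf] [g hg] /= fg0; have fg := ordmap_eq fg0.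
by subst g; rewrite (proof_irrelevance _ hf hg).
Qed.

Definition ordmap_id p : ordmap p p :=
  @OrdMap p p (fun i => i) (fun i j ij => ij).

Definition ordmap_comp p q r (g : ordmap q r) (f : ordmap p q) : ordmap p r :=
  @OrdMap p r (fun i => g (f i)) (fun i j ij => om_homo g (om_homo f ij)).

Definition ordinj_id p : ordinj p p :=
  @OrdInj p p (ordmap_id p) (fun i j ij => ij).

Definition ordinj_comp p q r (g : ordinj q r) (f : ordinj p q) : ordinj p r :=
  @OrdInj p r (ordmap_comp g f) (fun i j ij => oi_inj (oi_inj ij)).

Definition ordsurj_id p : ordsurj p p :=
  @OrdSurj p p (ordmap_id p) (fun j => ex_intro _ j erefl).

Definition Delta (n : nat) : Category.
Proof.
refine (@MkCategory 'I_n.+1 (fun p q => ordmap p q) (fun p => ordmap_id p)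
          (fun p q r g f => ordmap_comp g f) _ _ _) => *; exact: ordmap_eq.
Defined.

Definition DeltaPlus (n : nat) : Category.
Proof.
refine (@MkCategory 'I_n.+1 (fun p q => ordinj p q) (fun p => ordinj_id p)
          (fun p q r g f => ordinj_comp g f) _ _ _) => *; exact: ordinj_eq.
Defined.

Definition DeltaPlus_incl (n : nat) : Functor (Op (DeltaPlus n)) (Op (Delta n)).
Proof.
by refine (@MkFunctor (Op (DeltaPlus n)) (Op (Delta n)) (fun p => p)
          (fun p q (f : ordinj q p) => oi_map f) _ _).
Defined.

Definition SSet (n : nat) : Category := Fun (Op (DeltaPlus n)) SetCat.

Definition SimpSet (n : nat) : Category := Fun (Op (Delta n)) SetCat.

Definition forgetS (n : nat) (X : SimpSet n) : SSet n :=
  comp_functor X (DeltaPlus_incl n).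

(* [L(S)_p] is the coproduct, over the order-preserving surjections
   [p] ->> [q], of the sets [S_q]. *)
Definition Lcell (n : nat) (S : SSet n) (p : 'I_n.+1) : Type :=
  {q : 'I_n.+1 & (ordsurj p q * S q)%type}.

Definition lcell (n : nat) (S : SSet n) (p q : 'I_n.+1)
  (pi : ordsurj p q) (s : S q) : Lcell S p := existT _ q (pi, s).

Record factorization (p q : nat) (f : ordmap p q) := Factorization {
  fac_dim : nat;
  fac_epi : ordsurj p fac_dim;
  fac_mono : ordinj fac_dim q;
  facE : forall i, fac_mono (fac_epi i) = f i }.

Section EpiMono.
Variables (p q : nat) (f : ordmap p q).

Let A : {set 'I_q.+1} := [set f i | i : 'I_p.+1].

Let fA i : f i \in A. Proof. exact: imset_f. Qed.

Let cardA : #|A| = #|A|.-1.+1.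
Proof. by rewrite prednK //; apply/card_gt0P; exists (f ord0). Qed.

Let e_fun (i : 'I_p.+1) : 'I_(#|A|.-1).+1 :=
  cast_ord cardA (Order.enum_rank_in (fA ord0) (f i)).

Let e_homo (i j : 'I_p.+1) : i <= j -> e_fun i <= e_fun j.
Proof.
move=> ij.
have E := @Order.le_enum_rank_in _ _ (@Order.le_total _ _) _ _ (fA ord0)
  (f i) (f j) (fA i) (fA j).
have : (f i <= f j)%O by exact: om_homo.
by rewrite -E.
Qed.

Let m_fun (k : 'I_(#|A|.-1).+1) : 'I_q.+1 :=
  Order.enum_val (cast_ord (esym cardA) k).

Let m_homo (i j : 'I_(#|A|.-1).+1) : i <= j -> m_fun i <= m_fun j.
Proof.
move=> ij.
have E := @Order.le_enum_val _ _ (@Order.le_total _ _) A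
  (cast_ord (esym cardA) i) (cast_ord (esym cardA) j).
suff : (m_fun i <= m_fun j)%O by [].
by rewrite E.
Qed.

Let m_inj : injective m_fun.
Proof. by move=> i j /Order.enum_val_inj/cast_ord_inj. Qed.

Let meE i : m_fun (e_fun i) = f i.
Proof. by rewrite /m_fun /e_fun cast_ordK Order.enum_rankK_in. Qed.

Let e_surj k : exists i, e_fun i = k.
Proof.
have := Order.enum_valP (cast_ord (esym cardA) k).
case/imsetP=> i _ Ei; exists i; apply: m_inj; rewrite meE.
by rewrite -Ei.
Qed.

Lemma epi_mono : factorization f.
Proof.
exact: (@Factorization p q f _ (@OrdSurj _ _ (OrdMap e_homo) e_surj)
    (@OrdInj _ _ (OrdMap m_homo) m_inj) meE).
Qed.

Lemma fac_count (F : factorization f) i :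
  fac_epi F i = #|[set y in A | y < f i]| :> nat.
Proof.
case: F => r e m /= E.
have mlt k l : (m k < m l) = (k < l).
  apply/idP/idP; rewrite !ltnNge; apply: contra.
    by move/(om_homo m).
  rewrite leq_eqVlt => /orP[/eqP/val_inj/oi_inj -> //|/ltnW mkl].
  rewrite leqNgt; apply/negP => lk; have := om_homo m (ltnW lk) => mlk.
  have/val_inj/oi_inj eq_kl : val (m k) = val (m l).
    by apply/eqP; rewrite eqn_leq mlk mkl.
  by rewrite eq_kl ltnn in lk.
have -> : [set y in A | y < f i] = [set m k | k in [set k : 'I_r.+1 | k < e i]].
  apply/setP=> y; rewrite inE; apply/andP/imsetP.
    case=> /imsetP[j _ ->]; rewrite -!E mlt => lt_ji.
    by exists (e j) => //; rewrite inE.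
  case=> k; rewrite inE => ki ->; rewrite -E mlt; split=> //.
  by case: (os_surj e k) => j <-; rewrite E.
rewrite card_imset; last exact: oi_inj.
rewrite -[LHS](card_ord (e i)).
have le_ei : e i <= r.+1 by rewrite ltnW.
rewrite -(card_imset predT (f := widen_ord le_ei)); last first.
  by move=> a b /(congr1 val) /= /val_inj.
apply: eq_card => k; rewrite inE; apply/imsetP/idP => [[j _ ->] /= //|ki].
by exists (Ordinal ki) => //; apply: val_inj.
Qed.

End EpiMono.

Lemma ordsurj_max p r (e : ordsurj p r) : e ord_max = r :> nat.
Proof.
case: (os_surj e ord_max) => i Ei.
apply/eqP; rewrite eqn_leq -ltnS ltn_ord /=.
have : e i <= e ord_max by apply: om_homo; rewrite -ltnS.
by rewrite Ei.
Qed.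

Lemma fac_dim_uniq p q (f : ordmap p q) (F G : factorization f) :
  fac_dim F = fac_dim G.
Proof. by rewrite -(ordsurj_max (fac_epi F)) -(ordsurj_max (fac_epi G)) !fac_count. Qed.

Lemma fac_uniq p q (f : ordmap p q) r (e e' : ordsurj p r) (m m' : ordinj r q) :
  (forall i, m (e i) = f i) -> (forall i, m' (e' i) = f i) -> e = e' /\ m = m'.
Proof.
move=> E E'.
have ee' : e = e'.
  apply: ordsurj_eq => i; apply: val_inj.
  by rewrite /= (fac_count (Factorization E)) (fac_count (Factorization E')).
split=> //; subst e'; apply: ordinj_eq => k.
by case: (os_surj e k) => i <-; rewrite E E'.
Qed.

Lemma fac_dim_leq p q (f : ordmap p q) (F : factorization f) : fac_dim F <= p.
Proof.
case: F => r e m /= _.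
have : #|[set e i | i : 'I_p.+1]| <= p.+1.
  by apply: leq_trans (leq_imset_card _ _) _; rewrite card_ord.
rewrite (_ : [set e i | i : 'I_p.+1] = [set: 'I_r.+1]) ?cardsT ?card_ord //.
by apply/setP=> k; rewrite inE; case: (os_surj e k) => i <-; rewrite imset_f.
Qed.

Section Completion.
Variables (n : nat) (S : SSet n).

Lemma fac_ord_subproof (p q : 'I_n.+1) (f : ordmap p q) :
  fac_dim (epi_mono f) < n.+1.
Proof. exact: leq_ltn_trans (fac_dim_leq _) (ltn_ord p). Qed.

Definition fac_ord (p q : 'I_n.+1) (f : ordmap p q) : 'I_n.+1 :=
  Ordinal (fac_ord_subproof f).

(* [alpha : [p] -> [p']] sends [(pi, s)] to [(e, S(m) s)] where [m o e] is the
   epi-mono factorization of [pi o alpha]. *)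
Definition Lact (p' p : 'I_n.+1) (alpha : ordmap p p') (x : Lcell S p') :
    Lcell S p :=
  let F := epi_mono (ordmap_comp (projT2 x).1 alpha) in
  @lcell n S p (fac_ord (ordmap_comp (projT2 x).1 alpha)) (fac_epi F)
    (fmap S (fac_mono F : Mor (_ : Op (DeltaPlus n)) (fac_ord _)) (projT2 x).2).

Lemma lcell_fac (p q q1 q2 : 'I_n.+1) (f : ordmap p q) (s : S q)
    (e1 : ordsurj p q1) (m1 : ordinj q1 q) (e2 : ordsurj p q2) (m2 : ordinj q2 q) :
  (forall i, m1 (e1 i) = f i) -> (forall i, m2 (e2 i) = f i) ->
  lcell e1 (fmap S (m1 : Mor (q : Op (DeltaPlus n)) q1) s)
  = lcell e2 (fmap S (m2 : Mor (q : Op (DeltaPlus n)) q2) s).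
Proof.
move=> E1 E2.
have q12 : q1 = q2.
  exact/val_inj/(fac_dim_uniq (Factorization E1) (Factorization E2)).
subst q2; by have [-> ->] := fac_uniq E1 E2.
Qed.

Lemma LactE (p' p q' q : 'I_n.+1) (alpha : ordmap p p') (pi : ordsurj p' q')
    (s : S q') (e : ordsurj p q) (m : ordinj q q') :
  (forall i, m (e i) = pi (alpha i)) ->
  Lact alpha (lcell pi s)
  = lcell e (fmap S (m : Mor (q' : Op (DeltaPlus n)) q) s).
Proof.
move=> E; apply: (@lcell_fac p q' (fac_ord (ordmap_comp pi alpha)) q
  (ordmap_comp pi alpha)) => // i; exact: facE.
Qed.

Lemma Lact_id (p : 'I_n.+1) : Lact (ordmap_id p) = id.
Proof.
apply: functional_extensionality => -[q [pi s]].
rewrite (@LactE p p q q _ pi s pi (ordinj_id q)) //.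
by rewrite (fmap_id S).
Qed.

Lemma ord_fac (p q : 'I_n.+1) (f : ordmap p q) :
  exists (r : 'I_n.+1) (e : ordsurj p r) (m : ordinj r q), forall i, m (e i) = f i.
Proof.
exists (fac_ord f), (fac_epi (epi_mono f)), (fac_mono (epi_mono f)).
exact: facE.
Qed.

Lemma Lact_comp (p p' p'' : 'I_n.+1) (b : ordmap p p') (a : ordmap p' p'') :
  Lact (ordmap_comp a b) = fun x => Lact b (Lact a x).
Proof.
apply: functional_extensionality => -[q [pi s]].
have [r [e [m E]]] := ord_fac (ordmap_comp pi a).
have [t [e' [m' E']]] := ord_fac (ordmap_comp e b).
rewrite (LactE (alpha := a) s E) (LactE (alpha := b) _ E').
rewrite (@LactE _ _ q t _ pi s e' (ordinj_comp m m')); last first.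
  by move=> i /=; rewrite E' /= E.
congr lcell.
exact: (f_equal (fun h => h s) (fmap_comp S
  (m' : Mor (r : Op (DeltaPlus n)) t) (m : Mor (q : Op (DeltaPlus n)) r))).
Qed.

Definition L_of : SimpSet n :=
  @MkFunctor (Op (Delta n)) SetCat (fun p => Lcell S p)
    (fun p' p (a : ordmap p p') => Lact a) Lact_id
    (fun p'' p' p b a => Lact_comp b a).

Definition L_unit : NatTrans S (forgetS L_of).
Proof.
refine (@MkNatTrans _ _ S (forgetS L_of) (fun p s => lcell (ordsurj_id p) s) _).
move=> p q f; apply: functional_extensionality => s /=.
by rewrite (@LactE _ _ p q _ (ordsurj_id p) s (ordsurj_id q) f).
Defined.

Lemma L_universal (X : SimpSet n) (g : NatTrans S (forgetS X)) :
  exists h : NatTrans L_of X,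
    (forall (p : 'I_n.+1) (s : S p), h p (L_unit p s) = g p s)
    /\ forall h' : NatTrans L_of X,
         (forall (p : 'I_n.+1) (s : S p), h' p (L_unit p s) = g p s) -> h' = h.
Proof.
pose hf (p : 'I_n.+1) (x : Lcell S p) : X p :=
  fmap X ((projT2 x).1 : Mor (projT1 x : Op (Delta n)) p) (g _ (projT2 x).2).
have h_nat (p q : Op (Delta n)) (f : Mor p q) :
    (fun x => hf q (Lact f x)) = (fun x => fmap X f (hf p x)).
  apply: functional_extensionality => -[r [pi s]].
  have [t [e [m E]]] := ord_fac (ordmap_comp pi f).
  rewrite [LHS](f_equal (@hf q) (LactE (alpha := f) s E)) /= /hf /=.
  have := f_equal (fun k => k s) (ntc_nat g (m : Mor (r : Op (DeltaPlus n)) t)).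
  rewrite /= => ->.
  have Xc (a b c : Op (Delta n)) (u : Mor b c) (v : Mor a b) y :
    fmap X u (fmap X v y) = fmap X (u \oc v) y by rewrite (fmap_comp X).
  rewrite [LHS]Xc [RHS]Xc; congr (fmap X _ _).
  by apply: ordmap_eq => i; rewrite /= E.
exists (@MkNatTrans _ _ L_of X hf h_nat); split=> [p s|h' Hh'].
  by rewrite /= /hf /= -[RHS](f_equal (fun k => k (g p s)) (fmap_id X p)); congr (fmap X _ _); apply: ordmap_eq.
apply: nattrans_eq => p; apply: functional_extensionality => -[q [pi s]].
rewrite /= /hf /= -Hh'.
have := f_equal (fun k => k (lcell (ordsurj_id q) s)) (ntc_nat h' (pi : Mor (q : Op (Delta n)) p)).
rewrite /= (@LactE _ _ q q _ (ordsurj_id q) s pi (ordinj_id q)) // => <-.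
by rewrite (fmap_id S).
Qed.

End Completion.

Definition completion (n : nat) (S : SSet n) : SSet n := forgetS (L_of S).
Section NonSingular.
Variable n : nat.

Definition FSSet : Type := Functor (Op (DeltaPlus n)) FinSetCat.

Definition underlying (S : FSSet) : SSet n := comp_functor FinSet_incl S.

Definition cells (S : FSSet) (p : 'I_n.+1) : finType := S p.

Definition vertex_map p (i : 'I_p.+1) : ordinj 0 p.
Proof.
by refine (@OrdInj 0 p (@OrdMap 0 p (fun _ => i) (fun _ _ _ => leqnn i)) _) =>
  a b _; rewrite !ord1.
Defined.

Definition vert (S : FSSet) (p : 'I_n.+1) (s : cells S p) :
    {ffun 'I_p.+1 -> cells S ord0} :=
  [ffun i => fmap S (vertex_map i : Mor (p : Op (DeltaPlus n)) ord0) s].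

(* The finiteness of the set of all simplices is the fact that [ns_set] takes
   values in [FinSetCat]. *)
Record NSSet := MkNSSet {
  ns_set :> Functor (Op (DeltaPlus n)) FinSetCat;
  ns_vert_inj : forall p : 'I_n.+1, injective (@vert ns_set p);
  ns_vert_distinct : forall (p : 'I_n.+1) (s : cells ns_set p),
    (0 < p)%N -> injective (vert s) }.

Definition hat (S : NSSet) : SSet n := completion (underlying S).

(* The objects [hat S] are indexed by [S]; the morphisms are all the maps of
   semisimplicial sets between completions. *)
Definition SSnsHat : Category := Full hat.

(* [g_0 : S_0 -> T_0]: the identification of [hat(S)_0] with [S_0] is
   [s |-> (id, s)]; the one of [hat(T)_0] with [T_0] is written
   [(pi, t) |-> v_0(t)] to avoid a transport, as [t] has dimension 0. *)
Definition degree_zero (S T : NSSet) (g : Mor (hat S) (hat T)) :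
    cells S ord0 -> cells T ord0 :=
  fun s =>
    let x : Lcell (underlying T) ord0 :=
      (g : NatTrans _ _) ord0 (L_unit (underlying S) ord0 s) in
    vert (S := T) (projT2 x).2 ord0.

End NonSingular.

Section Simplices.
Variables (n : nat) (S : NSSet n).

(* The proposition [p <= n] as a finite type. *)
Definition dim_ok (p : nat) : finType := {u : unit | (p <= n)%N}.

Definition dim_ord p (h : dim_ok p) : 'I_n.+1 := @Ordinal n.+1 p (valP h).

(* The [p]-simplices of [S] for an arbitrary [p : nat]; there are none when
   [n < p]. *)
Definition simp (p : nat) : finType := {h : dim_ok p & cells S (dim_ord h)}.

Definition svert p (s : simp p) : {ffun 'I_p.+1 -> cells S ord0} :=
  vert (projT2 s).

Definition verts p (s : simp p) : seq (cells S ord0) :=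
  [seq svert s i | i <- enum 'I_p.+1].

Lemma ordinj_leq q p (f : ordinj q p) : (q <= p)%N.
Proof. by have := leq_card f (@oi_inj _ _ f); rewrite !card_ord. Qed.

Definition dim_ok_sub q p (f : ordinj q p) (h : dim_ok p) : dim_ok q :=
  exist (fun _ : unit => (q <= n)%N) tt (leq_trans (ordinj_leq f) (valP h)).

Definition restr q p (f : ordinj q p) (s : simp p) : simp q :=
  let h' := dim_ok_sub f (projT1 s) in
  existT (fun h => cells S (dim_ord h) : Type) h'
    (fmap S (f : Mor (dim_ord (projT1 s) : Op (DeltaPlus n)) (dim_ord h'))
       (projT2 s)).

Lemma coface_homo p (j : 'I_p.+2) (a b : 'I_p.+1) :
  (a <= b)%N -> (lift j a <= lift j b)%N.
Proof. by rewrite /= leq_bump2. Qed.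

Definition coface p (j : 'I_p.+2) : ordinj p p.+1 :=
  @OrdInj p p.+1 (OrdMap (@coface_homo p j)) (@lift_inj _ j).

Definition face p (j : 'I_p.+2) (s : simp p.+1) : simp p := restr (coface j) s.

Lemma svert_inj p : injective (@svert p).
Proof.
move=> [[[] h] s] [[[] h'] s']; rewrite /svert /=.
move: s'; rewrite (bool_irrelevance h' h) => s' E.
by have -> := @ns_vert_inj n S _ s s' E.
Qed.

Lemma svert_distinct p (s : simp p) : injective (svert s).
Proof.
case: p s => [|p] s; first by move=> i j _; rewrite !ord1.
exact: (@ns_vert_distinct n S _ (projT2 s) isT).
Qed.

Lemma svert_restr q p (f : ordinj q p) (s : simp p) i :
  svert (restr f s) i = svert s (f i).
Proof.
rewrite /svert /vert !ffunE /=.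
case: s => h s /=.
pose g : Mor (dim_ord (dim_ok_sub f h) : Op (DeltaPlus n)) ord0 := vertex_map i.
pose f' : Mor (dim_ord h : Op (DeltaPlus n)) (dim_ord (dim_ok_sub f h)) := f.
rewrite -[LHS](f_equal (fun k => k s) (fmap_comp (ns_set S) g f')).
have -> // : g \oc f' = vertex_map (f i).
exact: ordinj_eq.
Qed.

Lemma simp_eq p (s t : simp p) : svert s =1 svert t -> s = t.
Proof. by move=> E; apply: svert_inj; apply/ffunP. Qed.

Lemma nth_verts p (s : simp p) x0 (i : 'I_p.+1) : nth x0 (verts s) i = svert s i.
Proof. by rewrite (nth_map i) ?size_enum_ord // nth_ord_enum. Qed.

Lemma size_verts p (s : simp p) : size (verts s) = p.+1.
Proof. by rewrite size_map size_enum_ord. Qed.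

Lemma verts_inj p : injective (@verts p).
Proof.
move=> s t E; apply: simp_eq => i.
by rewrite -(nth_verts s (svert s i)) E nth_verts.
Qed.

Lemma simp_leq p (s : simp p) : (p <= n)%N.
Proof. exact: valP (projT1 s). Qed.

Section FrontBack.
Variables (q r : nat) (h : (q <= r)%N).

Lemma front_homo (i j : 'I_q.+1) : (i <= j)%N ->
  (widen_ord (h : q < r.+1)%N i <= widen_ord (h : q < r.+1)%N j)%N.
Proof. by []. Qed.

Lemma front_inj : injective (OrdMap front_homo).
Proof. by move=> i j /(congr1 val) /= /val_inj. Qed.

Definition front : ordinj q r := OrdInj front_inj.

Lemma back_subproof (i : 'I_q.+1) : (i + (r - q) < r.+1)%N.
Proof. by have := ltn_ord i; lia. Qed.

Lemma back_homo (i j : 'I_q.+1) : (i <= j)%N ->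
  (Ordinal (back_subproof i) <= Ordinal (back_subproof j))%N.
Proof. by rewrite /= leq_add2r. Qed.

Lemma back_inj : injective (OrdMap back_homo).
Proof. by move=> i j [] /addIn /val_inj. Qed.

Definition back : ordinj q r := OrdInj back_inj.
End FrontBack.

End Simplices.

Local Open Scope ring_scope.

Section Cochains.
Variables (k : fieldType) (n : nat) (S : NSSet n).

(* Free module on the [p]-simplices; for [p = 0] these are the functions on
   [S_0], and it is zero for [n < p]. *)
Definition Om (p : nat) : lmodType k := {ffun simp S p -> k^o}.

Definition rho p (s : simp S p) : Om p := [ffun t => (t == s)%:R].

(* [rho_s /\ rho_t] for [s = [v_0..v_p]] and [t = [w_0..w_q]]. *)
Definition rho_wedge p q r (s : simp S p) (t : simp S q) : Om r :=
  if svert s ord_max == svert t ord0 then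
    if [pick u : simp S r | verts u == verts s ++ behead (verts t)] is Some u
    then rho u else 0
  else 0.

Definition Om_wedge p q r (_ : (p + q)%N = r) (a : Om p) (b : Om q) : Om r :=
  \sum_s \sum_t (a s * b t : k) *: rho_wedge r s t.

Definition Om_one : Om 0 := \sum_s rho s.

Definition rho_diff p (s : simp S p) : Om p.+1 :=
  \sum_(j < p.+2) (-1) ^+ j *: \sum_(t | face j t == s) rho t.

Definition Om_diff p (a : Om p) : Om p.+1 := \sum_s (a s : k) *: rho_diff s.

Lemma rho_expand p (a : Om p) : a = \sum_s (a s : k) *: rho s.
Proof.
apply/ffunP=> t; rewrite sum_ffunE (bigD1 t) //= !ffunE eqxx big1.
  by rewrite addr0 [_ *: _]mulr1.
by move=> s st; rewrite !ffunE eq_sym (negPf st) scaler0.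
Qed.

Lemma leq_addr_eq p q r (h : (p + q)%N = r) : (p <= r)%N.
Proof. by rewrite -h leq_addr. Qed.
Lemma leq_addl_eq p q r (h : (p + q)%N = r) : (q <= r)%N.
Proof. by rewrite -h leq_addl. Qed.

Lemma rho_wedgeE p q r (h : (p + q)%N = r) s t (u : simp S r) :
  rho_wedge r s t u = ((s == restr (front (leq_addr_eq h)) u) &&
                       (t == restr (back (leq_addl_eq h)) u))%:R.
Proof.
set F := front _; set B := back _.
have key : (svert s ord_max == svert t ord0) &&
           (verts u == verts s ++ behead (verts t))
         = (s == restr F u) && (t == restr B u).
  apply/andP/andP => [[/eqP E /eqP V]|[/eqP -> /eqP ->]].
    have x0 := svert s ord0.
    have nthV i : (i < r.+1)%N -> svert u (inord i) =
        nth x0 (verts s ++ behead (verts t)) i.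
      by move=> ir; rewrite -V -(nth_verts u x0) inordK.
    split; apply/eqP/simp_eq => i; rewrite svert_restr.
      have ir : (i < r.+1)%N by have := ltn_ord i; lia.
      rewrite (_ : F i = inord i); last by apply: val_inj; rewrite /= inordK.
      by rewrite nthV // nth_cat size_verts ltn_ord nth_verts.
    have ir : (i + p < r.+1)%N by have := ltn_ord i; lia.
    rewrite (_ : B i = inord (i + p)); last first.
      by apply: val_inj; rewrite /= inordK //; lia.
    rewrite nthV // nth_cat size_verts.
    case: (posnP i) => [i0|i0].
      rewrite (_ : i = ord0); last by apply: val_inj.
      rewrite ltnS leqnn -E.
      by rewrite (_ : (ord0 + p)%N = @ord_max p) // nth_verts.
    rewrite (_ : (i + p < p.+1)%N = false); last by lia.
    rewrite nth_behead (_ : (i + p - p.+1).+1 = i) ?nth_verts //.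
    by lia.
  have E : svert (restr F u) ord_max = svert (restr B u) ord0.
    by rewrite !svert_restr; congr (svert u _); apply: val_inj => /=; lia.
  rewrite E; split=> //; apply/eqP.
  have x0 := svert u ord0.
  apply: (@eq_from_nth _ x0).
    by rewrite size_cat size_behead !size_verts; lia.
  move=> i; rewrite size_verts => ir.
  rewrite (nth_verts u x0 (Ordinal ir)) nth_cat size_verts.
  case: ltnP => [ip|ip].
    rewrite (nth_verts (restr F u) x0 (Ordinal ip)) svert_restr.
    by congr (svert u _); apply: val_inj.
  have iq : ((i - p.+1).+1 < q.+1)%N by lia.
  rewrite nth_behead (nth_verts (restr B u) x0 (Ordinal iq)) svert_restr.
  by congr (svert u _); apply: val_inj => /=; lia.
rewrite -key /rho_wedge; case: eqP => _ /=; last by rewrite ffunE.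
case: pickP => [u' /eqP E|/(_ u) -> ]; last by rewrite ffunE.
by rewrite ffunE -E (inj_eq (@verts_inj _ _ _)).
Qed.

Lemma Om_wedgeE p q r (h : (p + q)%N = r) a b u :
  Om_wedge h a b u = a (restr (front (leq_addr_eq h)) u) *
                     b (restr (back (leq_addl_eq h)) u).
Proof.
rewrite /Om_wedge sum_ffunE.
rewrite (bigD1 (restr (front (leq_addr_eq h)) u)) //= [X in _ + X]big1 ?addr0.
  rewrite sum_ffunE (bigD1 (restr (back (leq_addl_eq h)) u)) //=.
  rewrite [X in _ + X]big1 ?addr0; first by rewrite ffunE (rho_wedgeE h) !eqxx [LHS]mulr1.
  by move=> t tB; rewrite ffunE (rho_wedgeE h) (negPf tB) andbF [LHS]mulr0.
move=> s sF; rewrite sum_ffunE big1 // => t _.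
by rewrite ffunE (rho_wedgeE h) (negPf sF) [LHS]mulr0.
Qed.

Lemma Om_diffE p (a : Om p) u :
  Om_diff a u = \sum_(j < p.+2) (-1) ^+ j * a (face j u).
Proof.
rewrite /Om_diff sum_ffunE.
under eq_bigr => s _ do rewrite ffunE /rho_diff sum_ffunE scaler_sumr.
rewrite exchange_big; apply: eq_bigr => j _ /=.
rewrite (bigD1 (face j u)) //= [X in _ + X]big1 ?addr0.
  rewrite ffunE sum_ffunE (bigD1 u) //= [X in _ + X]big1 ?addr0.
    by rewrite ffunE eqxx /GRing.scale /= mulr1 mulrC.
  by move=> t /andP[_ tu]; rewrite ffunE eq_sym (negPf tu).
move=> s su; rewrite ffunE sum_ffunE big1 ?scaler0 // => t /eqP ts.
rewrite ffunE; case: eqP => // ut.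
by move: su; rewrite ut ts eqxx.
Qed.

Lemma Om_oneE u : Om_one u = 1.
Proof.
rewrite /Om_one sum_ffunE (bigD1 u) //= big1 ?addr0 ?ffunE ?eqxx //.
by move=> s su; rewrite ffunE eq_sym (negPf su).
Qed.

Lemma Om_wedge_linl p q r (h : (p + q)%N = r) b : linear (Om_wedge h ^~ b).
Proof.
move=> c a a'; apply/ffunP=> u.
by rewrite !ffunE !Om_wedgeE !ffunE /GRing.scale /= mulrDl mulrA.
Qed.

Lemma Om_wedge_linr p q r (h : (p + q)%N = r) a : linear (Om_wedge h a).
Proof.
move=> c b b'; apply/ffunP=> u.
by rewrite !ffunE !Om_wedgeE !ffunE /GRing.scale /= mulrDr mulrCA.
Qed.

Lemma Om_diff_lin p : linear (@Om_diff p).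
Proof.
move=> c a b; apply/ffunP=> u.
rewrite !ffunE !Om_diffE /GRing.scale /= mulr_sumr -big_split /=.
by apply: eq_bigr => j _; rewrite !ffunE /GRing.scale /= mulrDr mulrCA.
Qed.

Lemma restrr q r p (f : ordinj q p) (g : ordinj p r) (u : simp S r) i :
  svert (restr f (restr g u)) i = svert u (g (f i)).
Proof. by rewrite !svert_restr. Qed.

Lemma Om_wedgeA p q r pq qr s (h1 : (p + q)%N = pq) (h2 : (pq + r)%N = s)
    (h3 : (q + r)%N = qr) (h4 : (p + qr)%N = s) a b c :
  Om_wedge h2 (Om_wedge h1 a b) c = Om_wedge h4 a (Om_wedge h3 b c).
Proof.
apply/ffunP=> u; rewrite !Om_wedgeE mulrA.
congr (a _ * b _ * c _); apply: simp_eq => i; rewrite !svert_restr;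
  congr (svert u _); apply: val_inj => /=; lia.
Qed.

Lemma Om_wedge1l p (h : (0 + p)%N = p) a : Om_wedge h Om_one a = a.
Proof.
apply/ffunP=> u; rewrite Om_wedgeE Om_oneE mul1r.
congr (a _); apply: simp_eq => i; rewrite svert_restr.
by congr (svert u _); apply: val_inj => /=; lia.
Qed.

Lemma Om_wedge1r p (h : (p + 0)%N = p) a : Om_wedge h a Om_one = a.
Proof.
apply/ffunP=> u; rewrite Om_wedgeE Om_oneE mulr1.
congr (a _); apply: simp_eq => i; rewrite svert_restr.
by congr (svert u _); apply: val_inj.
Qed.

Lemma bump_swap i j : bump (bump i j) (unbump j i) = i.
Proof. by rewrite /bump /unbump; case: (leqP i j) => ij /=; lia. Qed.

Lemma unbump_swap i j : unbump (unbump j i) (bump i j) = j.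
Proof. by rewrite /bump /unbump; case: (leqP i j) => ij /=; lia. Qed.

Lemma swap_lt i j : ~~ (unbump j i < bump i j)%N = (j < i)%N.
Proof. by rewrite /bump /unbump; case: (leqP i j) => ij /=; lia. Qed.

Lemma odd_swap i j : (j < i)%N -> odd (i + j) = odd (bump i j + unbump j i).+1.
Proof. by rewrite /bump /unbump => ji; rewrite leqNgt ji /=; lia. Qed.

Lemma Om_diff2 p (a : Om p) : Om_diff (Om_diff a) = 0.
Proof.
apply/ffunP=> u; rewrite Om_diffE [RHS]ffunE.
under eq_bigr => j _ do rewrite Om_diffE mulr_sumr.
rewrite pair_big /=.
pose P (x : 'I_p.+3 * 'I_p.+2) := (x.2 < x.1)%N.
rewrite (bigID P) /=.
pose swap (x : 'I_p.+3 * 'I_p.+2) : 'I_p.+3 * 'I_p.+2 :=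
  (inord (bump x.1 x.2), inord (unbump x.2 x.1)).
have swap1 x : (swap x).1 = bump x.1 x.2 :> nat.
  by rewrite /= inordK //; exact: (ltn_ord (lift x.1 x.2)).
have swap2 x : (swap x).2 = unbump x.2 x.1 :> nat.
  rewrite /= inordK // /unbump.
  by have := ltn_ord x.1; have := ltn_ord x.2; lia.
have swapK : involutive swap.
  move=> x; rewrite [LHS]surjective_pairing [RHS]surjective_pairing.
  congr pair; apply: val_inj.
    rewrite [LHS]swap1 swap1 swap2 [RHS]/=; exact: bump_swap.
  rewrite [LHS]swap2 swap1 swap2 [RHS]/=; exact: unbump_swap.
rewrite [X in _ + X](reindex_inj (inv_inj swapK)) /=.
rewrite [X in _ + X](eq_bigl P); last first.
  by move=> x; rewrite /P swap1 swap2 swap_lt.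
apply/eqP; rewrite addr_eq0 -sumrN; apply/eqP/eq_bigr => x Px.
rewrite swap1 swap2 !mulrA -!exprD -mulNr -[- (_ ^+ _)]mulN1r -exprS.
congr (_ * a _); last first.
  apply: simp_eq => i; rewrite /face !restrr; congr (svert u _); apply: val_inj.
  by rewrite /= -/(swap x) bumpC swap1 swap2.
rewrite -signr_odd -[RHS]signr_odd; congr (_ ^+ _).
by rewrite (odd_swap Px).
Qed.

Lemma Om_leibniz p q r (h : (p + q)%N = r) (h1 : (p.+1 + q)%N = r.+1)
    (h2 : (p + q.+1)%N = r.+1) a b :
  Om_diff (Om_wedge h a b)
  = Om_wedge h1 (Om_diff a) b + (-1) ^+ p *: Om_wedge h2 a (Om_diff b).
Proof.
apply/ffunP=> u; rewrite Om_diffE !ffunE !Om_wedgeE !Om_diffE.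
rewrite /GRing.scale /= mulr_suml !mulr_sumr.
rewrite [X in _ = X + _]big_ord_recr [X in _ = _ + X]big_ord_recl /=.
set F1 := restr (front (leq_addr_eq h1)) u.
set B1 := restr (back (leq_addl_eq h1)) u.
set F2 := restr (front (leq_addr_eq h2)) u.
set B2 := restr (back (leq_addl_eq h2)) u.
have -> : face ord_max F1 = F2.
  apply: simp_eq => i; rewrite /face !restrr !svert_restr.
  by congr (svert u _); apply: val_inj; rewrite /= /bump; have := ltn_ord i; lia.
have -> : face ord0 B2 = B1.
  apply: simp_eq => i; rewrite /face !restrr !svert_restr.
  by congr (svert u _); apply: val_inj; rewrite /= /bump; have := ltn_ord i; lia.
have -> (x y s t : k) : x + (-1) ^+ p.+1 * s * t + ((-1) ^+ p * (s * ((-1) ^+ 0 * t)) + y)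
   = x + y by rewrite exprS expr0; ring.
pose G (j : nat) := (-1) ^+ j * Om_wedge h a b (face (inord j) u).
rewrite (eq_bigr (fun j : 'I_r.+2 => G j)); last by move=> j _; rewrite /G inord_val.
rewrite -(big_mkord xpredT G) (@big_cat_nat _ _ _ p.+1) //=; last by lia.
rewrite big_mkord; congr (_ + _).
  apply: eq_bigr => j _; rewrite /G Om_wedgeE mulrA.
  have jr : (j < r.+2)%N by have := ltn_ord j; lia.
  congr (_ * a _ * b _); apply: simp_eq => i; rewrite /face /F1 /B1 !svert_restr;
    congr (svert u _); apply: val_inj; rewrite /= /bump inordK //;
    by have := ltn_ord i; have := ltn_ord j; lia.
rewrite -{1}[p.+1]add0n big_addn (_ : (r.+2 - p.+1 = q.+1)%N); last by lia.
rewrite big_mkord; apply: eq_bigr => j _; rewrite /G Om_wedgeE.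
have jr : (j + p.+1 < r.+2)%N by have := ltn_ord j; lia.
rewrite (_ : restr (front (leq_addr_eq h)) _ = F2); last first.
  apply: simp_eq => i; rewrite /face !svert_restr.
  congr (svert u _); apply: val_inj; rewrite /= /bump inordK //.
  by have := ltn_ord i; lia.
rewrite (_ : restr (back (leq_addl_eq h)) _ = face (lift ord0 j) B2); last first.
  apply: simp_eq => i; rewrite /face !svert_restr.
  congr (svert u _); apply: val_inj; rewrite /= /bump inordK //.
  by have := ltn_ord i; lia.
by rewrite /bump leq0n add1n addnS -addSn exprD; ring.
Qed.

End Cochains.

Section Pullback.
Variables (n : nat).

Lemma vert_fmap (S : NSSet n) (p q : 'I_n.+1) (f : ordinj q p) (s : cells S p) i :
  vert (S := S) (fmap S (f : Mor (p : Op (DeltaPlus n)) q) s : cells S q) i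
  = vert s (f i).
Proof.
rewrite !ffunE.
pose g : Mor (q : Op (DeltaPlus n)) ord0 := vertex_map i.
pose f' : Mor (p : Op (DeltaPlus n)) q := f.
rewrite -[LHS](f_equal (fun k => k s) (fmap_comp (ns_set S) g f')).
have -> // : g \oc f' = vertex_map (f i).
exact: ordinj_eq.
Qed.

Lemma vert0 (S : NSSet n) (s : cells S ord0) : vert s ord0 = s.
Proof.
rewrite ffunE.
have -> : (vertex_map ord0 : Mor (ord0 : Op (DeltaPlus n)) ord0) = @idm (Op (DeltaPlus n)) ord0.
  by apply: ordinj_eq => i; rewrite (ord1 i).
by rewrite (fmap_id (ns_set S)).
Qed.

Lemma Lcell0 (S : NSSet n) (x : Lcell (underlying S) ord0) :
  x = L_unit (underlying S) ord0 (vert (S := S) (projT2 x).2 ord0).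
Proof.
case: x => q [pi t] /=.
have E : Lact (ordmap_id 0 : ordmap (@ord0 n) (@ord0 n)) (lcell (S := underlying S) pi t)
         = lcell pi t by rewrite Lact_id.
rewrite -[LHS]E.
have p0 : pi ord0 = ord0 by case: (os_surj pi ord0) => i; rewrite (ord1 i).
rewrite (@LactE n (underlying S) ord0 ord0 q ord0 (ordmap_id 0) pi t (ordsurj_id 0) (vertex_map (pi ord0))); last first.
  by move=> i; rewrite /= (ord1 i).
by rewrite p0 /= ffunE.
Qed.

Lemma degree_zero_vert (S T : NSSet n) (g : NatTrans (hat S) (hat T))
    (p : 'I_n.+1) (s : cells S p) (i : 'I_p.+1) :
  let x : Lcell (underlying T) p := g p (L_unit (underlying S) p s) in
  degree_zero (g : Mor (hat S) (hat T)) (vert s i)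
  = vert (S := T) (projT2 x).2 ((projT2 x).1 i).
Proof.
move=> x; rewrite /degree_zero.
pose v : Mor (p : Op (DeltaPlus n)) ord0 := vertex_map i.
have E1 : g ord0 (L_unit (underlying S) ord0 (vert s i))
          = Lact (S := underlying T) (vertex_map i : ordinj (@ord0 n) p) x.
  rewrite ffunE.
  have := f_equal (fun k => k s) (ntc_nat (L_unit (underlying S)) v).
  rewrite /= => ->.
  exact: (f_equal (fun k => k (L_unit (underlying S) p s)) (ntc_nat g v)).
rewrite E1; case: x {E1} => q [pi t].
have E2 : Lact (S := underlying T) (vertex_map i : ordinj (@ord0 n) p) (lcell (S := underlying T) pi t)
   = @lcell n (underlying T) ord0 ord0 (ordsurj_id 0)
      (fmap (underlying T) (vertex_map (pi i) : Mor (q : Op (DeltaPlus n)) ord0) t).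
  exact: LactE.
rewrite E2.
by rewrite /= (vert_fmap (vertex_map (pi i) : ordinj (@ord0 n) q)).
Qed.

Lemma degree_zero_id (S : NSSet n) (s : cells S ord0) :
  degree_zero (idm (hat S)) s = s.
Proof. by rewrite /degree_zero /= vert0. Qed.

Lemma degree_zero_comp (S T R : NSSet n) (g2 : Mor (hat T) (hat R))
    (g1 : Mor (hat S) (hat T)) (s : cells S ord0) :
  degree_zero (g2 \oc g1) s = degree_zero g2 (degree_zero g1 s).
Proof.
exact: (f_equal (fun x => vert (S := R)
  (projT2 ((g2 : NatTrans _ _) ord0 x : Lcell (underlying R) ord0)).2 ord0)
  (Lcell0 ((g1 : NatTrans _ _) ord0 (L_unit (underlying S) ord0 s)))).
Qed.

Variables (k : fieldType) (S T : NSSet n) (g : Mor (hat S) (hat T)).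

Definition rho_pull p (t : simp T p) : Om k S p :=
  \sum_(s : simp S p | [forall i, degree_zero g (svert s i) == svert t i])
    rho k s.

Definition Om_pull p (b : Om k T p) : Om k S p :=
  \sum_t (b t : k) *: rho_pull t.

Lemma Om_pullE p (b : Om k T p) s :
  Om_pull b s
  = \sum_(t : simp T p | [forall i, degree_zero g (svert s i) == svert t i]) b t.
Proof.
rewrite /Om_pull sum_ffunE [RHS]big_mkcond; apply: eq_bigr => t _ /=.
rewrite ffunE /rho_pull sum_ffunE big_mkcond (bigD1 s) //= ffunE eqxx.
rewrite big1 ?addr0; last first.
  by move=> s' ss'; case: ifP => // _; rewrite ffunE eq_sym (negPf ss').
by case: ifP => _; [rewrite [LHS]mulr1 | rewrite scaler0].
Qed.

Lemma Om_pull_lin p : linear (@Om_pull p).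
Proof.
move=> c a b; apply/ffunP=> s.
rewrite !ffunE !Om_pullE scaler_sumr -big_split /=.
by apply: eq_bigr => t _; rewrite !ffunE.
Qed.

Lemma Om_pull_match p (b : Om k T p) s t :
  (forall i, degree_zero g (svert s i) = svert t i) -> Om_pull b s = b t.
Proof.
move=> E; rewrite Om_pullE (big_pred1 t) // => t' /=.
apply/forallP/eqP => [E'|-> i]; last by rewrite E.
by apply: simp_eq => i; rewrite -(eqP (E' i)) E.
Qed.

Lemma Om_pull_degen p (b : Om k T p) s i j : i != j ->
  degree_zero g (svert s i) = degree_zero g (svert s j) -> Om_pull b s = 0.
Proof.
move=> ij E; rewrite Om_pullE big_pred0 // => t.
apply/negP => /forallP Et; case/eqP: ij; apply: (svert_distinct (s := t)).
by rewrite -(eqP (Et i)) -(eqP (Et j)).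
Qed.

Lemma pull_cases p (s : simp S p) :
  (exists t : simp T p, forall i, degree_zero g (svert s i) = svert t i) \/
  (exists2 c : nat, (c < p)%N & degree_zero g (svert s (inord c))
                              = degree_zero g (svert s (inord c.+1))).
Proof.
case: s => h s; rewrite /svert [projT1 _]/= [projT2 _]/=.
have D (i : 'I_p.+1) := @degree_zero_vert S T g (dim_ord h) s i.
move: D; set x := (g : NatTrans _ _) _ _; case: x => q [pi t] /= D.
case: (boolP [exists c : 'I_p, pi (inord c) == pi (inord c.+1)]) => [|no].
  by case/existsP=> c /eqP E; right; exists c => //; rewrite !D E.
left.
have step c : (c < p)%N -> (pi (inord c) < pi (inord c.+1))%N.
  move=> cp; move: no; rewrite negb_exists => /forallP/(_ (Ordinal cp)) /= ne.
  rewrite ltn_neqAle ne; apply: om_homo.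
  by rewrite !inordK // ltnW.
have lt_pi (i j : 'I_p.+1) : (i < j)%N -> (pi i < pi j)%N.
  case: j => j jp; elim: j jp => // j IH jp; rewrite ltnS => ij.
  have jp' : (j < p.+1)%N by rewrite ltnW.
  have lt1 := step j jp.
  rewrite (_ : Ordinal jp = inord j.+1); last by apply: val_inj; rewrite /= inordK.
  apply: leq_ltn_trans lt1; apply: om_homo.
  by rewrite inordK.
have pi_inj : injective pi.
  move=> i j E; apply: val_inj; case: (ltngtP i j) => // /lt_pi; by rewrite E ltnn.
pose t' : cells T (dim_ord h) :=
  fmap T (OrdInj pi_inj : Mor (q : Op (DeltaPlus n)) (dim_ord h)) t.
exists (existT (fun h => cells T (dim_ord h) : Type) h t') => i.
by rewrite D /= (vert_fmap (OrdInj pi_inj : ordinj (dim_ord h) q)).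
Qed.

Lemma Om_pull1 : Om_pull (Om_one k T) = Om_one k S.
Proof.
apply/ffunP=> s; rewrite Om_oneE.
case: (pull_cases s) => [[t E]|[]//].
by rewrite (Om_pull_match _ E) Om_oneE.
Qed.

Lemma Om_pullM p q r (h : (p + q)%N = r) a b :
  Om_pull (Om_wedge h a b) = Om_wedge h (Om_pull a) (Om_pull b).
Proof.
apply/ffunP=> s; rewrite Om_wedgeE.
case: (pull_cases s) => [[t E]|[c cr E]].
  rewrite (Om_pull_match _ E) Om_wedgeE.
  by congr (_ * _); symmetry; apply: Om_pull_match => i; rewrite !svert_restr E.
rewrite (Om_pull_degen _ (i := inord c) (j := inord c.+1)) //; last first.
  by rewrite -val_eqE /= !inordK //; [rewrite neq_ltn ltnSn|rewrite ltnW].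
case: (ltnP c p) => cp.
  rewrite (Om_pull_degen _ (i := inord c) (j := inord c.+1) (s := restr (front _) s)).
  - by rewrite mul0r.
  - by rewrite -val_eqE /= !inordK //; [rewrite neq_ltn ltnSn|rewrite ltnW].
  rewrite !svert_restr.
  rewrite (_ : front _ (inord c) = inord c); last first.
    by apply: val_inj => /=; rewrite !inordK //; lia.
  rewrite (_ : front _ (inord c.+1) = inord c.+1); last first.
    by apply: val_inj => /=; rewrite !inordK //; lia.
  exact: E.
rewrite (Om_pull_degen _ (i := inord (c - p)) (j := inord (c - p).+1) (s := restr (back _) s)).
- by rewrite mulr0.
- by rewrite -val_eqE /= !inordK //; lia.
rewrite !svert_restr.
rewrite (_ : back _ (inord (c - p)) = inord c); last first.
  by apply: val_inj => /=; rewrite !inordK //; lia.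
rewrite (_ : back _ (inord (c - p).+1) = inord c.+1); last first.
  by apply: val_inj => /=; rewrite !inordK //; lia.
exact: E.
Qed.

Lemma Om_pulld p a : Om_pull (@Om_diff k n T p a) = Om_diff (Om_pull a).
Proof.
apply/ffunP=> s; rewrite Om_diffE.
case: (pull_cases s) => [[t E]|[c cr E]].
  rewrite (Om_pull_match _ E) Om_diffE; apply: eq_bigr => j _; congr (_ * _).
  by symmetry; apply: Om_pull_match => i; rewrite /face !svert_restr E.
pose c0 : 'I_p.+2 := inord c; pose c1 : 'I_p.+2 := inord c.+1.
have c0E : c0 = c :> nat by rewrite inordK // ltnW.
have c1E : c1 = c.+1 :> nat by rewrite inordK.
have c01 : c0 != c1 by rewrite -val_eqE /= c0E c1E neq_ltn ltnSn.
rewrite (Om_pull_degen _ c01) //.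
rewrite (bigD1 c0) //= (bigD1 c1) 1?eq_sym //= big1 ?addr0; last first.
  move=> j /andP[jc0 jc1].
  have [i0 Ei0 _] := unlift_some jc0; have [i1 Ei1 _] := unlift_some jc1.
  rewrite (Om_pull_degen _ (i := i0) (j := i1)) ?mulr0 //.
    by apply: contraNneq c01 => i01; rewrite Ei0 Ei1 i01.
  by rewrite /face !svert_restr /= -Ei0 -Ei1.
suff -> : Om_pull a (face c1 s) = Om_pull a (face c0 s).
  by rewrite c0E c1E exprS mulN1r mulNr subrr.
rewrite !Om_pullE; apply: eq_bigl => t; apply: eq_forallb => i.
suff -> : degree_zero g (svert (face c1 s) i) = degree_zero g (svert (face c0 s) i) by [].
rewrite /face !svert_restr; case: (eqVneq (i : nat) c) => ic.
  have -> : coface c1 i = c0.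
    by apply: val_inj; change (bump c1 i = c0); rewrite c1E c0E /bump ic ltnn.
  have -> : coface c0 i = c1.
    by apply: val_inj; change (bump c0 i = c1); rewrite c0E c1E /bump ic leqnn.
  exact: E.
congr (degree_zero _ (svert s _)); apply: val_inj.
change (bump c1 i = bump c0 i); rewrite c0E c1E /bump; congr (_ + _)%N.
by rewrite [in RHS]leq_eqVlt eq_sym (negPf ic).
Qed.

End Pullback.

Lemma Om_pull_id (k : fieldType) (n : nat) (S : NSSet n) p (a : Om k S p) :
  Om_pull (idm (hat S)) a = a.
Proof.
by apply/ffunP=> s; apply: Om_pull_match => i; rewrite degree_zero_id.
Qed.

Lemma Om_pull_comp (k : fieldType) (n : nat) (S T R : NSSet n)
    (g2 : Mor (hat T) (hat R)) (g1 : Mor (hat S) (hat T)) p (a : Om k R p) :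
  Om_pull (g2 \oc g1) a = Om_pull g1 (Om_pull g2 a).
Proof.
apply/ffunP=> s; case: (pull_cases g1 s) => [[t E]|[c cr E]].
  rewrite (Om_pull_match _ E) !Om_pullE; apply: eq_bigl => u.
  by apply: eq_forallb => i; rewrite degree_zero_comp E.
have ne : (inord c : 'I_p.+1) != inord c.+1.
  by rewrite -val_eqE /= !inordK //; [rewrite neq_ltn ltnSn|rewrite ltnW].
by rewrite !(Om_pull_degen _ ne) // !degree_zero_comp E.
Qed.

(* The grading is the family [gr]; [wedge] carries a proof of [p + q = r] so that
   no transport is needed to state associativity and the Leibniz rule. *)
Record DGA (k : fieldType) := MkDGA {
  gr :> nat -> lmodType k;
  wedge : forall p q r : nat, (p + q)%N = r -> gr p -> gr q -> gr r;
  dga1 : gr 0;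
  diff : forall p, gr p -> gr p.+1;
  wedge_linl : forall p q r (h : (p + q)%N = r) b, linear (wedge h ^~ b);
  wedge_linr : forall p q r (h : (p + q)%N = r) a, linear (wedge h a);
  wedgeA : forall p q r pq qr s (h1 : (p + q)%N = pq) (h2 : (pq + r)%N = s)
      (h3 : (q + r)%N = qr) (h4 : (p + qr)%N = s) a b c,
    wedge h2 (wedge h1 a b) c = wedge h4 a (wedge h3 b c);
  wedge1l : forall p (h : (0 + p)%N = p) a, wedge h dga1 a = a;
  wedge1r : forall p (h : (p + 0)%N = p) a, wedge h a dga1 = a;
  diff_lin : forall p, linear (@diff p);
  diff_diff : forall p (a : gr p), diff (diff a) = 0;
  leibniz : forall p q r (h : (p + q)%N = r) (h1 : (p.+1 + q)%N = r.+1)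
      (h2 : (p + q.+1)%N = r.+1) a b,
    diff (wedge h a b)
    = wedge h1 (diff a) b + (-1) ^+ p *: wedge h2 a (diff b) }.

Arguments wedge {k} A {p q r} h a b : rename.
Arguments dga1 {k} A : rename.
Arguments diff {k} A {p} a : rename.

Record DGAHom (k : fieldType) (A B : DGA k) := MkDGAHom {
  dgahom :> forall p, A p -> B p;
  dgahom_lin : forall p, linear (@dgahom p);
  dgahom1 : dgahom (dga1 A) = dga1 B;
  dgahomM : forall p q r (h : (p + q)%N = r) a b,
    dgahom (wedge A h a b) = wedge B h (dgahom a) (dgahom b);
  dgahomd : forall p (a : A p), dgahom (diff A a) = diff B (dgahom a) }.

Section DGACategory.
Variable k : fieldType.

Lemma dgahom_eq (A B : DGA k) (f g : DGAHom A B) :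
  (forall p (a : A p), f p a = g p a) -> f = g.
Proof.
case: f g => [f lf f1 fM fd] [g lg g1 gM gd] /= fg.
have E : f = g.
  apply: functional_extensionality_dep => p.
  by apply: functional_extensionality => a; apply: fg.
subst g; rewrite (proof_irrelevance _ lf lg) (proof_irrelevance _ f1 g1).
by rewrite (proof_irrelevance _ fM gM) (proof_irrelevance _ fd gd).
Qed.

Definition dgahom_id (A : DGA k) : DGAHom A A :=
  @MkDGAHom k A A (fun p a => a) (fun p c a b => erefl) erefl
    (fun p q r h a b => erefl) (fun p a => erefl).

Definition dgahom_comp (A B C : DGA k) (g : DGAHom B C) (f : DGAHom A B) :
  DGAHom A C.
Proof.
refine (@MkDGAHom k A C (fun p a => g p (f p a)) _ _ _ _).
- by move=> p c a b; rewrite !dgahom_lin.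
- by rewrite !dgahom1.
- by move=> p q r h a b; rewrite !dgahomM.
- by move=> p a; rewrite !dgahomd.
Defined.

Definition DGACat : Category.
Proof.
by refine (@MkCategory (DGA k) (@DGAHom k) dgahom_id dgahom_comp _ _ _) =>
  *; apply: dgahom_eq.
Defined.

Definition concentrated (n : nat) (A : DGACat) : Prop :=
  forall p (a : (A : DGA k) p), (n < p)%N -> a = 0.

Definition DG (n : nat) : Category := FullSub (concentrated n).

End DGACategory.

Section OmegaFunctor.
Variables (k : fieldType) (n : nat).

Definition Omega_dga (S : NSSet n) : DGA k :=
  @MkDGA k (Om k S) (@Om_wedge k n S) (Om_one k S) (@Om_diff k n S)
    (@Om_wedge_linl k n S) (@Om_wedge_linr k n S) (@Om_wedgeA k n S)
    (@Om_wedge1l k n S) (@Om_wedge1r k n S) (@Om_diff_lin k n S)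
    (@Om_diff2 k n S) (@Om_leibniz k n S).

Lemma Omega_concentrated (S : NSSet n) : concentrated n (Omega_dga S : DGACat k).
Proof.
move=> p a np; apply/ffunP => s.
by have := simp_leq s; rewrite leqNgt np.
Qed.

Definition Omega_obj (S : NSSet n) : DG k n :=
  exist _ (Omega_dga S) (@Omega_concentrated S).

Definition Omega_mor (S T : NSSet n) (g : Mor (hat S) (hat T)) :
    DGAHom (Omega_dga T) (Omega_dga S) :=
  @MkDGAHom k (Omega_dga T) (Omega_dga S) (@Om_pull n k S T g)
    (@Om_pull_lin n k S T g) (Om_pull1 k g) (@Om_pullM n k S T g)
    (@Om_pulld n k S T g).

Definition Omega : Functor (Op (SSnsHat n)) (DG k n).
Proof.
refine (@MkFunctor (Op (SSnsHat n)) (DG k n) Omega_obj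
          (fun T S (g : Mor (hat S) (hat T)) => Omega_mor g) _ _).
- by move=> S; apply: dgahom_eq => p a; apply: Om_pull_id.
- by move=> R T S g1 g2; apply: dgahom_eq => p a; apply: Om_pull_comp.
Defined.

End OmegaFunctor.

Definition is_basis_of (k : fieldType) (V : lmodType k) (I : finType)
    (J : I -> Prop) (F : I -> V) (W : V -> Prop) : Prop :=
  [/\ forall i, J i -> W (F i),
      forall c : I -> k, (forall i, ~ J i -> c i = 0) ->
        \sum_i c i *: F i = 0 -> forall i, c i = 0
    & forall w, W w -> exists2 c : I -> k,
        (forall i, ~ J i -> c i = 0) & w = \sum_i c i *: F i].

Section Conditions.
Variables (k : fieldType) (A : DGA k).

Fixpoint wprod (w : nat -> A 1) (p : nat) : A p :=
  match p with
  | 0 => dga1 A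
  | p'.+1 => wedge A (addn1 p') (wprod w p') (w p')
  end.

(* The image of [(A 1)^{(x) p} -> A p] consists of the finite sums of [p]-fold
   products of elements of [A 1]. *)
Definition exterior : Prop :=
  (forall w : A 1, exists (N : nat) (f g : 'I_N -> A 0),
     w = \sum_i wedge A (add0n 1) (f i) (diff A (g i)))
  /\ (forall p, (0 < p)%N -> forall w : A p,
        exists (N : nat) (u : 'I_N -> nat -> A 1), w = \sum_i wprod (u i) p).

Variables (X : finType) (iota : {ffun X -> k^o} -> A 0).

Definition is_algebra_iso : Prop :=
  [/\ linear iota, bijective iota, iota [ffun=> 1] = dga1 A
    & forall f g : {ffun X -> k^o},
        iota [ffun x => (f x : k) * g x] = wedge A (addn0 0) (iota f) (iota g)].

Definition delta (x : X) : A 0 := iota [ffun y => (y == x)%:R].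

Definition block p (x y : X) (w : A p) : Prop :=
  exists u : A p,
    w = wedge A (addn0 p) (wedge A (add0n p) (delta x) u) (delta y).

Definition block_zero p (x y : X) : Prop := forall w : A p, block x y w -> w = 0.

Definition omega (x y : X) : A 1 :=
  if x == y then 0 else wedge A (add0n 1) (delta x) (diff A (delta y)).

Definition Ebar (x y : X) : Prop := x <> y /\ ~ block_zero 1 x y.

Definition is_path p (x y : X) (v : {ffun 'I_p.+1 -> X}) : Prop :=
  [/\ v ord0 = x, v ord_max = y
    & forall i, (i < p)%N -> Ebar (v (inord i)) (v (inord i.+1))].

Definition mpath p (v : {ffun 'I_p.+1 -> X}) : A p :=
  wprod (fun i => omega (v (inord i)) (v (inord i.+1))) p.

Definition D1 : Prop := is_algebra_iso /\ exterior.

Definition D2 : Prop :=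
  forall p (x y : X), (1 < p)%N -> block_zero 1 x y -> block_zero p x y.

Definition D3 (n : nat) : Prop :=
  forall p (x y : X), (1 <= p <= n)%N ->
    is_basis_of (fun v : {ffun 'I_p.+1 -> X} => is_path x y v /\ mpath v <> 0)
      (@mpath p) (@block p x y).

End Conditions.

Definition in_DGhat (k : fieldType) (n : nat) (A : DG k n) : Prop :=
  exists (X : finType) (iota : {ffun X -> k^o} -> (sval A : DGA k) 0),
    [/\ D1 iota, D2 iota & D3 iota n].

Definition DGhat (k : fieldType) (n : nat) : Category := FullSub (@in_DGhat k n).

(* Main.v *)
(* Let A be a DGA satisfying (D1)-(D3), with idempotents delta_x. A tuple
   (v_0, ..., v_p) of points of X gives the product
   delta_{v_0} omega_{[v_0,v_1]} ... omega_{[v_{p-1},v_p]}; by (D3) the non-zero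
   ones form a basis of A^p. The Leibniz rule shows that the differential of the
   product of v is the alternating sum, over all ways of inserting one point
   into v, of the products of the longer tuples. Hence, if a tuple has a non-zero
   product, so have its faces: otherwise the differential of the vanishing product
   of the face would be a linear relation between basis elements. Moreover
   Omega^1_{x,x} = 0 by exteriority and so Omega^p_{x,x} = 0 by (D2), which forces the
   entries of such a tuple to be distinct. The tuples with non-zero product thus
   form a non-singular complex whose cochain algebra is A.

   For full faithfulness, a cell of L(T) is determined by its vertices, so a
   morphism of completions is determined by its degree-zero part, and a morphism
   out of an exterior DGA is determined in degree 0. Conversely a morphism
   h : Omega_T -> Omega_S is dual in degree 0 to a map on vertices; if this map sends no
   two consecutive vertices of a simplex s to the same point, the image under h of
   the path product of the image tuple has coefficient 1 at s, so that this tuple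
   is a simplex of T. Consecutive repetitions are removed by a degeneracy. *)
Require Import Defs.
From HB Require Import structures.
From mathcomp Require Import all_boot all_algebra.
From mathcomp Require Import zify.
From Stdlib Require Import FunctionalExtensionality IndefiniteDescription.

Set Implicit Arguments.
Unset Strict Implicit.
Unset Printing Implicit Defensive.

Import GRing.Theory.
Local Open Scope ring_scope.

(** * Equivalences and isomorphisms *)

Section Equivalence.
Variables (C D : Category) (F : Functor C D).

Definition faithful : Prop :=
  forall (x y : C) (f g : Mor x y), fmap F f = fmap F g -> f = g.

Definition full : Prop :=
  forall (x y : C) (h : Mor (F x) (F y)), exists f : Mor x y, fmap F f = h.

Hypotheses (Ff : faithful) (Fu : full) (Fe : forall y, ess_image F y).

Let G0 (y : D) : C := sval (constructive_indefinite_description _ (Fe y)).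

Let iso_data (y : D) : {fg : Mor (F (G0 y)) y * Mor y (F (G0 y)) |
   fg.2 \oc fg.1 = idm _ /\ fg.1 \oc fg.2 = idm _}.
Proof.
apply: constructive_indefinite_description.
have [f [g fg]] := svalP (constructive_indefinite_description _ (Fe y)).
by exists (f, g).
Qed.

Let e y := (sval (iso_data y)).1.
Let e' y := (sval (iso_data y)).2.
Let e'e y : e' y \oc e y = idm _. Proof. by case: (svalP (iso_data y)). Qed.
Let ee' y : e y \oc e' y = idm _. Proof. by case: (svalP (iso_data y)). Qed.

Let lift_mor x y (h : Mor (F x) (F y)) : Mor x y :=
  sval (constructive_indefinite_description _ (Fu h)).

Let lift_morE x y (h : Mor (F x) (F y)) : fmap F (lift_mor h) = h.
Proof. exact: svalP (constructive_indefinite_description _ (Fu h)). Qed.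

Let Gmor x y (f : Mor x y) : Mor (G0 x) (G0 y) := lift_mor (e' y \oc (f \oc e x)).

Let Gmor_id x : Gmor (idm x) = idm (G0 x).
Proof. by apply: Ff; rewrite lift_morE comp_idl e'e fmap_id. Qed.

Let Gmor_comp x y z (g : Mor y z) (f : Mor x y) :
  Gmor (g \oc f) = Gmor g \oc Gmor f.
Proof.
apply: Ff; rewrite fmap_comp !lift_morE !Defs.compA.
by rewrite -[e' z \oc g \oc e y \oc e' y]Defs.compA ee' comp_idr.
Qed.

Let G : Functor D C := MkFunctor Gmor_id Gmor_comp.

(** The quasi-inverse [G] sends [y] to a chosen preimage and [f] to the lift of its conjugate by the
    chosen isomorphisms. These isomorphisms and their lifts are the components of the two natural
    isomorphisms; identities in [C] are checked after applying the faithful [F]. *)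
Lemma full_faithful_equivalence : is_equivalence F.
Proof.
exists G; split.
- have nat (x y : C) (f : Mor x y) :
    lift_mor (e (F y)) \oc fmap (comp_functor G F) f
    = fmap (id_functor C) f \oc lift_mor (e (F x)).
    apply: Ff; rewrite !fmap_comp [fmap (comp_functor G F) f]/= !lift_morE.
    by rewrite !Defs.compA ee' comp_idl.
  exists (@MkNatTrans C C (comp_functor G F) (id_functor C)
    (fun x => lift_mor (e (F x))) nat) => x /=; exists (lift_mor (e' (F x))).
  by split; apply: Ff; rewrite !fmap_comp !lift_morE ?e'e ?ee' fmap_id.
- have nat (x y : D) (f : Mor x y) :
    e y \oc fmap (comp_functor F G) f = fmap (id_functor D) f \oc e x.
    by rewrite [fmap (comp_functor F G) f]/= lift_morE !Defs.compA ee' comp_idl.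
  exists (@MkNatTrans D D (comp_functor F G) (id_functor D) e nat) => x /=.
  exists (e' x); split; [exact: e'e|exact: ee'].
Qed.

End Equivalence.

Section BijectiveHom.
Variables (k : fieldType) (A B : DGA k) (f : DGAHom A B).
Hypotheses (f_inj : forall p, injective (f p)).
Hypotheses (f_surj : forall p b, exists a, f p a = b).

Let f_surjb p b : exists a, f p a == b.
Proof. by have [a <-] := f_surj b; exists a. Qed.

Let f_inv p b := xchoose (@f_surjb p b).

Let f_invK p b : f p (f_inv b) = b.
Proof. exact/eqP/(xchooseP (f_surjb b)). Qed.

(** The inverse is chosen degree by degree; its compatibilities are checked after applying the
    injective [f]. *)
Lemma bijective_dgahom : @is_iso (DGACat k) A B f.
Proof.
have lin p : linear (@f_inv p).
  by move=> c a b; apply: f_inj; rewrite dgahom_lin !f_invK.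
have one : f_inv (dga1 B) = dga1 A by apply: f_inj; rewrite dgahom1 f_invK.
have mul p q r (h : (p + q)%N = r) a b :
    f_inv (wedge B h a b) = wedge A h (f_inv a) (f_inv b).
  by apply: f_inj; rewrite dgahomM !f_invK.
have dif p (a : B p) : f_inv (diff B a) = diff A (f_inv a).
  by apply: f_inj; rewrite dgahomd !f_invK.
exists (MkDGAHom lin one mul dif : @Mor (DGACat k) B A).
by split; apply: dgahom_eq => p a /=; [apply: f_inj|]; rewrite f_invK.
Qed.

End BijectiveHom.

(** * Calculus in a differential graded algebra *)

Section LinearFacts.
Variables (k : fieldType) (U V : lmodType k) (f : U -> V) (lf : linear f).

(** A [DGA] states linearity as a predicate on bare functions; bundling such a function gives access
    to the library lemmas on linear maps. *)
Let g : {linear U -> V} := HB.pack f (GRing.isLinear.Build k U V *:%R f lf).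

Lemma lin0 : f 0 = 0. Proof. exact: (linear0 g). Qed.
Lemma linD : {morph f : x y / x + y}. Proof. exact: (linearD g). Qed.
Lemma linN : {morph f : x / - x}. Proof. exact: (linearN g). Qed.
Lemma linB : {morph f : x y / x - y}. Proof. exact: (linearB g). Qed.
Lemma linZ a : {morph f : x / a *: x}. Proof. exact: (linearZ_LR g). Qed.
Lemma lin_sum (I : Type) (r : seq I) (P : pred I) (E : I -> U) :
  f (\sum_(i <- r | P i) E i) = \sum_(i <- r | P i) f (E i).
Proof. exact: (linear_sum g). Qed.

End LinearFacts.

Section WedgeFacts.
Variables (k : fieldType) (A : DGA k).

Lemma wedge_irr p q r (h h' : (p + q)%N = r) (a : A p) (b : A q) :
  wedge A h a b = wedge A h' a b.
Proof. by rewrite (eq_irrelevance h h'). Qed.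

Section Bilinear.
Variables (p q r : nat) (h : (p + q)%N = r).

Lemma wedge0l (b : A q) : wedge A h 0 b = 0.
Proof. exact: (lin0 (wedge_linl h b)). Qed.
Lemma wedge0r (a : A p) : wedge A h a 0 = 0.
Proof. exact: (lin0 (wedge_linr h a)). Qed.
Lemma wedgeNl (a : A p) (b : A q) : wedge A h (- a) b = - wedge A h a b.
Proof. exact: (linN (wedge_linl h b)). Qed.
Lemma wedgeNr (a : A p) (b : A q) : wedge A h a (- b) = - wedge A h a b.
Proof. exact: (linN (wedge_linr h a)). Qed.
Lemma wedgeDr (a : A p) (b b' : A q) :
  wedge A h a (b + b') = wedge A h a b + wedge A h a b'.
Proof. exact: (linD (wedge_linr h a)). Qed.
Lemma wedgeZl c (a : A p) (b : A q) : wedge A h (c *: a) b = c *: wedge A h a b.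
Proof. exact: (linZ (wedge_linl h b)). Qed.
Lemma wedgeZr c (a : A p) (b : A q) : wedge A h a (c *: b) = c *: wedge A h a b.
Proof. exact: (linZ (wedge_linr h a)). Qed.
Lemma wedge_suml (I : Type) (s : seq I) (P : pred I) (E : I -> A p) (b : A q) :
  wedge A h (\sum_(i <- s | P i) E i) b = \sum_(i <- s | P i) wedge A h (E i) b.
Proof. exact: (lin_sum (wedge_linl h b)). Qed.
Lemma wedge_sumr (I : Type) (s : seq I) (P : pred I) (E : I -> A q) (a : A p) :
  wedge A h a (\sum_(i <- s | P i) E i) = \sum_(i <- s | P i) wedge A h a (E i).
Proof. exact: (lin_sum (wedge_linr h a)). Qed.

End Bilinear.

Lemma diff_sum p (I : Type) (s : seq I) (P : pred I) (E : I -> A p) :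
  diff A (\sum_(i <- s | P i) E i) = \sum_(i <- s | P i) diff A (E i).
Proof. exact: (lin_sum (@diff_lin k A p)). Qed.

(** The Leibniz rule for the product of 1 with itself reads [d1 = d1 + d1]. *)
Lemma diff1 : diff A (dga1 A) = 0.
Proof.
have := @leibniz _ A 0 0 0 (addn0 0) (addn0 1) (add0n 1) (dga1 A) (dga1 A).
rewrite expr0 scale1r wedge1l (wedge1r (addn0 1)) (wedge1l (add0n 1)).
by move/eqP; rewrite -subr_eq subrr => /eqP.
Qed.

(** Used to meet [exterior], which asks for sums of products without coefficients: the first factor
    absorbs the scalar. *)
Lemma wprod_scale c (w : nat -> A 1) p : (0 < p)%N ->
  wprod (fun i => if i == 0%N then c *: w i else w i) p = c *: wprod w p.
Proof.
case: p => // p _; elim: p => [|p IH] /=; first by rewrite wedgeZr.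
by rewrite -/(wprod _ p.+1) IH wedgeZl.
Qed.

Lemma wprod1 (w : nat -> A 1) : wprod w 1 = w 0%N.
Proof. by rewrite /= (wedge_irr _ (add0n 1)) wedge1l. Qed.

End WedgeFacts.

(** * Primitive idempotents and the elements [omega] *)

Section Idempotents.
Variables (k : fieldType) (A : DGA k) (X : finType).
Variables (iota : {ffun X -> k^o} -> A 0) (A1 : is_algebra_iso iota).

Local Notation dl := (delta iota).
Local Notation om := (omega iota).

Lemma iota_expand f : iota f = \sum_x (f x : k) *: dl x.
Proof.
have [lin _ _ _] := A1.
rewrite [in LHS](_ : f = \sum_x (f x : k) *: ([ffun y => (y == x)%:R] : {ffun X -> k^o})).
  by rewrite (lin_sum lin); apply: eq_bigr => x _; rewrite (linZ lin).
apply/ffunP=> t; rewrite sum_ffunE (bigD1 t) //= !ffunE eqxx big1.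
  by rewrite addr0 [_ *: _]mulr1.
by move=> s st; rewrite !ffunE eq_sym (negPf st) scaler0.
Qed.

Lemma deg0_expand a : exists f : {ffun X -> k^o}, a = \sum_x (f x : k) *: dl x.
Proof.
have [_ [g _ iK] _ _] := A1.
by exists (g a); rewrite -iota_expand iK.
Qed.

Lemma sum_delta : \sum_x dl x = dga1 A.
Proof.
have [_ _ <- _] := A1; rewrite iota_expand.
by apply: eq_bigr => x _; rewrite ffunE scale1r.
Qed.

Lemma delta_mul (h : (0 + 0)%N = 0%N) x y :
  wedge A h (dl x) (dl y) = if x == y then dl x else 0.
Proof.
have [lin _ _ mul] := A1.
rewrite (wedge_irr h (addn0 0)) -mul; case: eqP => [<-|/eqP xy].
  by congr iota; apply/ffunP => z; rewrite !ffunE; case: eqP; rewrite ?mulr1 ?mulr0.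
rewrite -[RHS](lin0 lin); congr iota; apply/ffunP => z; rewrite !ffunE.
by case: eqP => [->|_]; [rewrite (negPf xy) mulr0|rewrite mul0r].
Qed.

Lemma expandl p (h : (0 + p)%N = p) (a : A p) : a = \sum_x wedge A h (dl x) a.
Proof. by rewrite -wedge_suml sum_delta wedge1l. Qed.

Lemma expandr p (h : (p + 0)%N = p) (a : A p) : a = \sum_x wedge A h a (dl x).
Proof. by rewrite -wedge_sumr sum_delta wedge1r. Qed.

(** As [dl x] is idempotent, lying in the left (or right) ideal component of a point is a
    fixed-point equation; this replaces the existential in [block]. *)
Definition starts p x (a : A p) := wedge A (add0n p) (dl x) a = a.
Definition ends p y (a : A p) := wedge A (addn0 p) a (dl y) = a.

Lemma starts_neq p x y (h : (0 + p)%N = p) (a : A p) :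
  starts x a -> wedge A h (dl y) a = if y == x then a else 0.
Proof.
move=> sa; rewrite (wedge_irr h (add0n p)) -[in LHS]sa.
rewrite -(wedgeA (addn0 0) (add0n p)) delta_mul.
by case: eqP => [->|_]; rewrite ?sa ?wedge0l.
Qed.

Lemma ends_neq p x y (h : (p + 0)%N = p) (a : A p) :
  ends x a -> wedge A h a (dl y) = if x == y then a else 0.
Proof.
move=> sa; rewrite (wedge_irr h (addn0 p)) -[in LHS]sa.
rewrite (wedgeA _ _ (addn0 0) (addn0 p)) delta_mul.
by case: eqP => _; rewrite ?sa ?wedge0r.
Qed.

Lemma starts_wedge p q r (h : (p + q)%N = r) x (a : A p) (b : A q) :
  starts x a -> starts x (wedge A h a b).
Proof. by move=> sa; rewrite /starts -(wedgeA (add0n p) h) sa. Qed.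

Lemma ends_wedge p q r (h : (p + q)%N = r) x (a : A p) (b : A q) :
  ends x b -> ends x (wedge A h a b).
Proof. by move=> sa; rewrite /ends (wedgeA _ _ (addn0 q) h) sa. Qed.

Lemma wedge_mismatch p q r (h : (p + q)%N = r) x y (a : A p) (b : A q) :
  ends x a -> starts y b -> x != y -> wedge A h a b = 0.
Proof.
move=> ea sb xy; rewrite -sb -(wedgeA (addn0 p) h).
by rewrite (ends_neq y _ ea) (negPf xy) wedge0l.
Qed.

Lemma block_starts_ends p x y (w : A p) :
  block iota x y w <-> starts x w /\ ends y w.
Proof.
split=> [[u ->]|[sw ew]].
  split; last first.
    by apply: ends_wedge; rewrite /ends delta_mul eqxx.
  by apply/starts_wedge/starts_wedge; rewrite /starts delta_mul eqxx.
by exists w; rewrite sw ew.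
Qed.

Lemma delta_starts x : starts x (dl x).
Proof. by rewrite /starts delta_mul eqxx. Qed.

Lemma delta_ends x : ends x (dl x).
Proof. by rewrite /ends delta_mul eqxx. Qed.

Lemma leibniz0 (h : (0 + 0)%N = 0%N) (h1 : (1 + 0)%N = 1%N) (h2 : (0 + 1)%N = 1%N)
    (a b : A 0) :
  diff A (wedge A h a b) = wedge A h1 (diff A a) b + wedge A h2 a (diff A b).
Proof. by rewrite (leibniz h h1 h2) expr0 scale1r. Qed.

(** Multiply the Leibniz rule for [dl y] times [dl z] by [dl x] on the left: the second term
    contains [dl x] times [dl y], which is zero. *)
Lemma delta_ddelta_delta x y z : x != y ->
  wedge A (addn0 1) (wedge A (add0n 1) (dl x) (diff A (dl y))) (dl z)
  = if z == y then wedge A (add0n 1) (dl x) (diff A (dl y)) else 0.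
Proof.
move=> xy; have := leibniz0 (addn0 0) (addn0 1) (add0n 1) (dl y) (dl z).
move/(congr1 (wedge A (add0n 1) (dl x))).
rewrite wedgeDr -!(wedgeA (addn0 0) (add0n 1)) -(wedgeA (add0n 1) (addn0 1)).
rewrite delta_mul (starts_neq _ _ (delta_starts _)) (negPf xy) wedge0l addr0 => <-.
rewrite eq_sym; case: eqP => // _.
by rewrite (lin0 (@diff_lin _ A 0)) wedge0r.
Qed.

Lemma omega_starts x y : starts x (om x y).
Proof.
rewrite /starts /omega; case: eqP => _; first by rewrite wedge0r.
by apply: starts_wedge; apply: delta_starts.
Qed.

Lemma omega_ends x y : ends y (om x y).
Proof.
rewrite /ends /omega; case: eqP => [_|/eqP xy]; first by rewrite wedge0l.
by rewrite delta_ddelta_delta // eqxx.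
Qed.

Lemma omegaxx x : om x x = 0.
Proof. by rewrite /omega eqxx. Qed.

Definition omega_in x := \sum_z om z x.
Definition omega_out x := \sum_z om x z.

(** Split [d(delta_x)] by the idempotent on its left. The components at [y != x] are [om y x]; the
    one at [x] follows from [d1 = 0], which equates it with minus the sum of the [om x y]. *)
Lemma ddelta x : diff A (dl x) = omega_in x - omega_out x.
Proof.
have E y : y != x -> wedge A (add0n 1) (dl y) (diff A (dl x)) = om y x.
  by rewrite /omega => /negPf->.
rewrite [LHS](expandl (add0n 1)) (bigD1 x) //= (eq_bigr (om^~ x)) //.
rewrite /omega_in [X in _ = X - _](bigD1 x) //= omegaxx add0r [RHS]addrC.
congr (_ + _).
have: wedge A (add0n 1) (dl x) (diff A (\sum_y dl y)) = 0.
  by rewrite sum_delta diff1 wedge0r.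
rewrite diff_sum wedge_sumr (bigD1 x) //= => /eqP; rewrite addr_eq0 => /eqP->.
congr (- _); rewrite /omega_out [RHS](bigD1 x) //= omegaxx add0r.
by apply: eq_bigr => y; rewrite /omega eq_sym => /negPf->.
Qed.

Lemma omega_out_starts x : starts x (omega_out x).
Proof.
by rewrite /starts wedge_sumr; apply: eq_bigr => y _; apply: omega_starts.
Qed.

Lemma omega_in_ends x : ends x (omega_in x).
Proof.
by rewrite /ends wedge_suml; apply: eq_bigr => y _; apply: omega_ends.
Qed.

Lemma ddelta_diag x :
  wedge A (addn0 1) (wedge A (add0n 1) (dl x) (diff A (dl x))) (dl x) = 0.
Proof.
rewrite ddelta (linB (wedge_linr (add0n 1) _)) omega_out_starts wedge_sumr.
rewrite (bigD1 x) //= omegaxx wedge0r add0r big1 => [|y yx]; last first.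
  by rewrite (starts_neq _ _ (omega_starts y x)) eq_sym (negPf yx).
rewrite sub0r wedgeNl wedge_suml big1 ?oppr0 // => y _.
by rewrite (ends_neq _ _ (omega_ends x y)); case: eqP => // ->; rewrite omegaxx.
Qed.

Lemma delta_ddelta_diag x y :
  wedge A (addn0 1) (wedge A (add0n 1) (dl x) (diff A (dl y))) (dl x) = 0.
Proof.
have [<-|xy] := eqVneq x y; first exact: ddelta_diag.
by rewrite delta_ddelta_delta // (negPf xy).
Qed.

Hypothesis A2 : exterior A.

(** Exteriority reduces the claim to elements [delta_x d(delta_y) delta_x], which are zero by
    [delta_ddelta_diag]. *)
Lemma block1_diag x : block_zero iota 1 x x.
Proof.
move=> w [u ->] {w}; have [[N [f [g ->]]] _] := (A2.1 u, A2.2).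
rewrite wedge_sumr wedge_suml big1 // => i _.
have [f' ->] := deg0_expand (f i); have [g' ->] := deg0_expand (g i).
rewrite -(wedgeA (add0n 0) (add0n 1)) wedge_sumr.
rewrite (bigD1 x) //= big1 => [|y yx]; last first.
  by rewrite wedgeZr delta_mul eq_sym (negPf yx) scaler0.
rewrite addr0 wedgeZr delta_mul eqxx !wedgeZl diff_sum wedge_sumr wedge_suml.
rewrite big1 ?scaler0 // => y _.
by rewrite (linZ (@diff_lin _ A 0)) wedgeZr wedgeZl delta_ddelta_diag scaler0.
Qed.

Hypothesis A3 : D2 iota.

Lemma block_diag p x : (0 < p)%N -> block_zero iota p x x.
Proof.
case: p => [|[|p]] // _; first exact: block1_diag.
by apply: A3 => //; apply: block1_diag.
Qed.

(** For [x != y] the left side is [d(delta_x) d(delta_y)], because [d d = 0]. Substituting [ddelta]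
    and matching the idempotents between the two factors leaves the three sums. *)
Lemma domega x y (h : (1 + 1)%N = 2%N) :
  diff A (om x y) = \sum_z wedge A h (om z x) (om x y)
                  - \sum_z wedge A h (om x z) (om z y)
                  + \sum_z wedge A h (om x y) (om y z).
Proof.
have loop z : wedge A h (om x z) (om z x) = 0.
  apply: (block_diag (p := 2) (x := x)) => //; apply/block_starts_ends; split.
    by apply: starts_wedge; apply: omega_starts.
  by apply: ends_wedge; apply: omega_ends.
(* On the diagonal everything vanishes: the middle sum by [loop], the other terms because they
   contain [om x x]. *)
have [<-|xy] := eqVneq x y.
  rewrite [in LHS]omegaxx (lin0 (@diff_lin _ A 1)) !big1 ?subr0 ?addr0 // => z _.
  - by rewrite omegaxx wedge0l.
  - by rewrite omegaxx wedge0r.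
have -> : diff A (om x y) = wedge A h (diff A (dl x)) (diff A (dl y)).
  rewrite {1}/omega (negPf xy) (leibniz (add0n 1) h (add0n 2)).
  by rewrite diff_diff wedge0r scaler0 addr0.
rewrite [in wedge A h _ _](ddelta x) (linB (wedge_linl h _)).
rewrite -addrA; congr (_ + _).
  rewrite -(omega_in_ends x) (wedgeA _ _ (add0n 1) h) -wedge_suml; congr wedge.
  by rewrite /omega (negPf xy).
(* Against [omega_in y] each summand [om x z] meets only [om z y]; against [omega_out y] only the
   summand [om x y] survives. *)
rewrite ddelta (linB (wedge_linr h _)) opprB [LHS]addrC; congr (- _ + _).
  rewrite {1}/omega_out wedge_suml; apply: eq_bigr => z _.
  rewrite -(omega_ends x z) (wedgeA _ _ (add0n 1) h) [in LHS]/omega_in.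
  rewrite wedge_sumr (bigD1 z) //= omega_starts big1 ?addr0.
    by rewrite (omega_ends x z).
  by move=> t tz; rewrite (starts_neq _ _ (omega_starts t y)) eq_sym (negPf tz).
rewrite -(omega_out_starts y) -(wedgeA (addn0 1) h) /omega_out wedge_suml.
rewrite (bigD1 y) //= omega_ends big1 ?addr0 ?wedge_sumr //.
by move=> t ty; rewrite (ends_neq _ _ (omega_ends x t)) (negPf ty).
Qed.

End Idempotents.

(** * Products along paths and their differential *)

Section PathProducts.
Variables (k : fieldType) (A : DGA k) (X : finType).
Variables (iota : {ffun X -> k^o} -> A 0).

Local Notation dl := (delta iota).
Local Notation om := (omega iota).

(* Starting from [delta (w 0)] rather than from [1] makes the differential
   formula [diff_pprod] valid also for [p = 0]. *)
Fixpoint pprod (w : nat -> X) (p : nat) : A p :=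
  match p with
  | 0 => dl (w 0)
  | p'.+1 => wedge A (addn1 p') (pprod w p') (om (w p') (w p'.+1))
  end.

Lemma eq_pprod w w' p : (forall i, (i <= p)%N -> w i = w' i) -> pprod w p = pprod w' p.
Proof.
elim: p => [|p IH] E /=; first by rewrite E.
by rewrite IH ?E // => i ip; rewrite E // ltnW.
Qed.

Hypothesis A1 : is_algebra_iso iota.

Lemma pprodE w p :
  (0 < p)%N -> pprod w p = wprod (fun i => om (w i) (w i.+1)) p.
Proof.
case: p => // p _; elim: p => [|p IH] /=.
  rewrite (wedge_irr _ (add0n 1)) (omega_starts A1).
  by rewrite (wedge_irr _ (add0n 1)) wedge1l.
by rewrite -[wedge A (addn1 p) (pprod w p) _]/(pprod w p.+1) IH.
Qed.

Lemma pprod_starts w p : starts iota (w 0%N) (pprod w p).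
Proof.
elim: p => [|p IH] /=; first exact: delta_starts.
exact: starts_wedge.
Qed.

Lemma pprod_ends w p : ends iota (w p) (pprod w p).
Proof.
case: p => [|p] /=; first exact: delta_ends.
by apply: ends_wedge; apply: omega_ends.
Qed.

(** The second product begins with the idempotent of [w p], at which the first one ends, so it is
    absorbed. *)
Lemma pprod_cat w p q r (h : (p + q)%N = r) :
  wedge A h (pprod w p) (pprod (fun i => w (p + i)%N) q) = pprod w r.
Proof.
elim: q r h => [|q IH] r h /=.
  have pr : r = p by rewrite -h addn0.
  case: _ / (esym pr) h => h; rewrite (wedge_irr h (addn0 p)).
  have -> : w (p + 0)%N = w p by rewrite addn0.
  exact: pprod_ends.
case: r h => [|r] h; first by lia.
have h' : (p + q)%N = r by move: h; rewrite addnS => -[].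
rewrite -(wedgeA h' (addn1 r)) IH /=.
by rewrite !addnS h'.
Qed.

Lemma pprod_neq0_omega w p i :
  pprod w p != 0 -> (i < p)%N -> om (w i) (w i.+1) != 0.
Proof.
elim: p => // p IH /= nz; rewrite ltnS leq_eqVlt => /orP[/eqP->|ip].
  by apply: contraNneq nz => ->; rewrite wedge0r.
apply: IH => //; apply: contraNneq nz => ->; by rewrite wedge0l.
Qed.

Hypotheses (A2 : exterior A) (A3 : D2 iota).

(** If [w i = w j], the segment between them lies in a diagonal block of positive degree, and such
    blocks vanish. *)
Lemma pprod_neq0_inj w p i j :
  pprod w p != 0 -> (i < j)%N -> (j <= p)%N -> w i != w j.
Proof.
move=> nz ij jp; apply: contraNneq nz => E.
rewrite -(pprod_cat w (subnKC jp)) -(pprod_cat w (subnKC (ltnW ij))).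
suff -> : pprod (fun m => w (i + m)%N) (j - i) = 0 by rewrite wedge0r wedge0l.
apply: (block_diag A1 A2 A3 (x := w i)); first by rewrite subn_gt0.
apply/(block_starts_ends A1); split.
  by have := pprod_starts (fun m => w (i + m)%N) (j - i); rewrite addn0.
rewrite {1}E; have := pprod_ends (fun m => w (i + m)%N) (j - i).
by rewrite subnKC // ltnW.
Qed.

Definition insert_at (i : nat) (z : X) (w : nat -> X) : nat -> X :=
  fun m => if (m < i)%N then w m else if m == i then z else w m.-1.

Lemma insert_at_lt i z w m : (m < i)%N -> insert_at i z w m = w m.
Proof. by rewrite /insert_at => ->. Qed.

Lemma insert_at_eq i z w : insert_at i z w i = z.
Proof. by rewrite /insert_at ltnn eqxx. Qed.

Lemma insert_at_gt i z w m : (i <= m)%N -> insert_at i z w m.+1 = w m.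
Proof.
by move=> im; rewrite /insert_at ltnNge leqW //= eqn_leq ltnNge im.
Qed.

(** Induction on [p] with the Leibniz rule. Insertions at positions up to [p] come from the
    differential of the shorter product. Those at [p + 1] and [p + 2] come from the last two sums of
    [domega], whose signs turn [(-1)^p] into [(-1)^(p+1)] and [(-1)^(p+2)]. *)
Lemma diff_pprod w p :
  diff A (pprod w p)
  = \sum_(i < p.+2) (-1) ^+ i *: \sum_z pprod (insert_at i z w) p.+1.
Proof.
elim: p => [|p IH].
  rewrite [in LHS]/= (ddelta A1) !big_ord_recl big_ord0 addr0 expr0 scale1r.
  rewrite expr1 scaleN1r; congr (_ - _); apply: eq_bigr => z _ /=.
    by rewrite (wedge_irr _ (add0n 1)) (omega_starts A1).
  by rewrite (wedge_irr _ (add0n 1)) (omega_starts A1).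
rewrite [in LHS]/= (leibniz (addn1 p) (addn1 p.+1) (addn2 p)) {}IH.
rewrite wedge_suml (domega A1 A2 A3 _ _ (addn1 1)).
rewrite big_ord_recr [RHS]big_ord_recr [X in _ = X + _]big_ord_recr /=.
rewrite -!addrA; congr (_ + _).
  apply: eq_bigr => i _; rewrite wedgeZl wedge_suml; congr (_ *: _).
  apply: eq_bigr => z _; have ip := ltn_ord i.
  by rewrite !insert_at_gt // ltnW.
(* The induction hypothesis also inserts [z] after [w p], in front of a factor starting at [w p]. If
   [z] differs from [w p] the idempotents do not match; otherwise a factor [om (w p) (w p)]
   occurs. *)
rewrite wedgeZl wedge_suml [X in _ *: X + _]big1 ?scaler0 ?add0r; last first.
  move=> z _.
  rewrite insert_at_lt // insert_at_eq.
  have [->|wz] := eqVneq z (w p); first by rewrite omegaxx wedge0r wedge0l.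
  apply: (wedge_mismatch A1 _ (x := z) (y := w p)) => //.
    by apply: ends_wedge; apply: omega_ends.
  exact: omega_starts.
(* The first sum of [domega] dies likewise, between [pprod w p] and [om z (w p)]. *)
rewrite !wedgeDr wedgeNr !wedge_sumr [X in X + _]big1 ?add0r; last first.
  move=> z _; rewrite -(wedgeA (addn1 p) (addn1 p.+1)).
  have [->|wz] := eqVneq z (w p); first by rewrite omegaxx wedge0r wedge0l.
  rewrite (wedge_mismatch A1 _ (pprod_ends w p) (omega_starts A1 z (w p))) ?wedge0l //.
  by rewrite eq_sym.
have low i z : (p < i)%N -> pprod (insert_at i z w) p = pprod w p.
  by move=> pi; apply: eq_pprod => m mp; rewrite insert_at_lt // (leq_ltn_trans mp).
rewrite exprS [in RHS]exprS exprS !mulN1r opprK !scaleNr scalerDr scalerN.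
congr (- (_ *: _) + _ *: _); apply: eq_bigr => z _.
  rewrite low // insert_at_lt // insert_at_eq insert_at_gt //.
  by rewrite (wedgeA (addn1 p) (addn1 p.+1) (addn1 1) (addn2 p)).
rewrite low // insert_at_eq !insert_at_lt //.
by rewrite (wedgeA (addn1 p) (addn1 p.+1) (addn1 1) (addn2 p)).
Qed.

End PathProducts.

(** * Products along vertex tuples *)

Section Tuples.
Variable X : Type.

Definition fcomp q p (v : {ffun 'I_p.+1 -> X}) (f : 'I_q.+1 -> 'I_p.+1) :
  {ffun 'I_q.+1 -> X} := [ffun i => v (f i)].

Definition fface p (j : 'I_p.+2) (v : {ffun 'I_p.+2 -> X}) := fcomp v (lift j).

(** Such an [f] is also surjective, so [f] after the identity and the identity after [f] are two
    epi-mono factorizations of one map; these are unique. *)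
Lemma ordinj_endo p (f : ordinj p p) : f = ordinj_id p.
Proof.
have surj j : exists i, f i = j by exists (invF (@oi_inj _ _ f) j); rewrite f_invF.
pose e := @OrdSurj p p (oi_map f) surj.
by have [] := @fac_uniq p p (oi_map f) p (ordsurj_id p) e f (ordinj_id p).
Qed.

(** Induction on the target dimension: an injection from a smaller ordinal misses some [j], hence
    factors through [lift j]. *)
Lemma face_closed_ordinj (P : forall p, {ffun 'I_p.+1 -> X} -> Prop) :
  (forall p j (v : {ffun 'I_p.+2 -> X}), P _ v -> P _ (fface j v)) ->
  forall q p (f : ordinj q p) v, P _ v -> P _ (fcomp v f).
Proof.
move=> Pface q p; have [m] := ubnP p; elim: m q p => // m IH q p pm f v Pv.
have := ordinj_leq f; rewrite leq_eqVlt => /orP[/eqP qp|qp].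
  subst q; rewrite (ordinj_endo f) (_ : fcomp _ _ = v) //.
  by apply/ffunP => i; rewrite ffunE.
case: p f v Pv qp pm => // p f v Pv qp pm.
have [j jf] : exists j, j \notin codom f.
  apply/existsP; rewrite -negb_forall; apply/negP => /forallP all_f.
  have := subset_leq_card
    (introT subsetP (fun j _ => all_f j) : [set: 'I_p.+2] \subset codom f).
  by rewrite cardsT card_codom ?card_ord; [rewrite leqNgt ltnS qp|exact: oi_inj].
have fj i : j != f i by apply: contraNneq jf => ->; apply: codom_f.
pose g i := odflt ord0 (unlift j (f i)).
have gE i : lift j (g i) = f i.
  by rewrite /g; have [i' E ->] := unlift_some (fj i).
have g_inj : injective g by move=> a b E; apply: (oi_inj (o := f)); rewrite -!gE E.
have g_homo (a b : 'I_q.+1) : (a <= b)%N -> (g a <= g b)%N.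
  by move=> /(om_homo f); rewrite -!gE /= leq_bump2.
have -> : fcomp v f = fcomp (fface j v) (@OrdInj q p (OrdMap g_homo) g_inj).
  by apply/ffunP => i; rewrite !ffunE gE.
by apply: IH => //; apply: Pface.
Qed.

End Tuples.

Section TupleProducts.
Variables (k : fieldType) (A : DGA k) (X : finType).
Variables (iota : {ffun X -> k^o} -> A 0).

Local Notation dl := (delta iota).
Local Notation om := (omega iota).

Definition tprod p (v : {ffun 'I_p.+1 -> X}) : A p :=
  pprod iota (fun i => v (inord i)) p.

Lemma tprod0 (v : {ffun 'I_1 -> X}) : tprod v = dl (v ord0).
Proof.
rewrite /tprod /= (_ : inord 0 = ord0) //.
by apply: val_inj; rewrite /= inordK.
Qed.

Hypotheses (A1 : is_algebra_iso iota).

Lemma tprod_mpath p (v : {ffun 'I_p.+1 -> X}) : (0 < p)%N -> tprod v = mpath iota v.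
Proof. exact: pprodE. Qed.

Lemma tprod_starts p (v : {ffun 'I_p.+1 -> X}) : starts iota (v ord0) (tprod v).
Proof.
have := pprod_starts A1 (fun i => v (inord i)) p.
by rewrite (_ : inord 0 = ord0) //; apply: val_inj; rewrite /= inordK.
Qed.

Lemma tprod_ends p (v : {ffun 'I_p.+1 -> X}) : ends iota (v ord_max) (tprod v).
Proof.
have := pprod_ends A1 (fun i => v (inord i)) p.
by rewrite (_ : inord p = ord_max) //; apply: val_inj; rewrite /= inordK.
Qed.

Hypotheses (A2 : exterior A) (A3 : D2 iota).

Lemma tprod_neq0_inj p (v : {ffun 'I_p.+1 -> X}) : tprod v != 0 -> injective v.
Proof.
move=> nz; have lt (i j : 'I_p.+1) : (i < j)%N -> v i != v j.
  by move=> ij; have := pprod_neq0_inj A1 A2 A3 nz ij (leq_ord j); rewrite !inord_val.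
move=> i j E; apply: val_inj; case: (ltngtP i j) => // /lt; rewrite E eqxx //.
Qed.

Lemma insert_at_bump (j m : nat) (z : X) w : insert_at j z w (bump j m) = w m.
Proof.
rewrite /bump; case: leqP => jm; first by rewrite insert_at_gt.
by rewrite insert_at_lt.
Qed.

(** This is [diff_pprod] reindexed by the longer tuple [u], the inserted point being [u j]. A tuple
    with repetitions can arise from several positions, hence the inner sum of signs. *)
Lemma diff_tprod p (v : {ffun 'I_p.+1 -> X}) :
  diff A (tprod v)
  = \sum_u (\sum_(j < p.+2 | fface j u == v) (-1) ^+ j) *: tprod u.
Proof.
rewrite /tprod (diff_pprod A1 A2 A3).
under [RHS]eq_bigr => u _ do rewrite scaler_suml big_mkcond /=.
rewrite exchange_big /=; apply: eq_bigr => j _; rewrite -big_mkcond -scaler_sumr.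
congr (_ *: _); set w := fun i => v (inord i).
rewrite (reindex_onto (fun z => [ffun i : 'I_p.+2 => insert_at j z w i])
  (fun u : {ffun 'I_p.+2 -> X} => u j)) /=; last first.
  move=> u /eqP/ffunP E; apply/ffunP => i; rewrite ffunE.
  have [i' ->|->] := unliftP j i; last by rewrite insert_at_eq.
  by rewrite insert_at_bump /w inord_val -E !ffunE.
rewrite [RHS](eq_bigl predT) => [|z]; last first.
  rewrite ffunE insert_at_eq eqxx andbT; apply/eqP/ffunP => i.
  by rewrite !ffunE /= insert_at_bump /w inord_val.
by apply: eq_bigr => z _; apply: eq_pprod => i ip; rewrite ffunE inordK.
Qed.

Variable n : nat.
Hypotheses (A4 : D3 iota n) (An : forall p (a : A p), (n < p)%N -> a = 0).

(** (D3) gives independence inside one block and in positive degree. Multiplying by the idempotents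
    at the ends of [v] isolates its block; in degree 0 one idempotent suffices. *)
Lemma tprod_free p (c : {ffun 'I_p.+1 -> X} -> k) :
  \sum_v c v *: tprod v = 0 -> forall v, tprod v != 0 -> c v = 0.
Proof.
move=> c0 v nz; have [p0|p0] := posnP p.
  subst p; have := congr1 (wedge A (add0n 0) (dl (v ord0))) c0.
  rewrite wedge0r wedge_sumr (bigD1 v) //= wedgeZr tprod_starts big1 => [|u uv].
    by rewrite addr0 => /eqP; rewrite scaler_eq0 (negPf nz) orbF => /eqP.
  rewrite wedgeZr (starts_neq A1 _ _ (tprod_starts u)) ifN ?scaler0 //.
  by apply: contraNneq uv => E; apply/eqP/ffunP => i; rewrite (ord1 i).
have pn : (p <= n)%N.
  by rewrite leqNgt; apply: contraNN nz => np; apply/eqP; apply: An.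
pose J (u : {ffun 'I_p.+1 -> X}) :=
  [&& u ord0 == v ord0, u ord_max == v ord_max & tprod u != 0].
have [|_ free _] := @A4 p (v ord0) (v ord_max); first by rewrite p0.
pose c' u := if J u then c u else 0.
suff: c' v = 0 by rewrite /c' /J !eqxx nz.
apply: free => [u nJ|].
  (* A non-vanishing product runs along a path: each factor [om] is a non-zero element of its block
     of degree 1. *)
  rewrite /c'; case: ifP => // /and3P[/eqP u0 /eqP um unz]; case: nJ; split.
    split=> // i ip; have om_nz := pprod_neq0_omega unz ip.
    split=> [E|Z]; first by move: om_nz; rewrite E omegaxx eqxx.
    move/eqP: om_nz; apply; apply: Z; apply/(block_starts_ends A1).
    by split; [apply: omega_starts | apply: omega_ends].
  by rewrite -tprod_mpath //; apply/eqP.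
pose cut a := wedge A (addn0 p) (wedge A (add0n p) (dl (v ord0)) a) (dl (v ord_max)).
have := congr1 cut c0.
rewrite /cut wedge0r wedge0l wedge_sumr wedge_suml => E.
rewrite -[RHS]E; apply: eq_bigr => u _; rewrite wedgeZr wedgeZl /c' /J.
rewrite (starts_neq A1 _ _ (tprod_starts u)) eq_sym.
have [E0|_] := eqVneq; last by rewrite wedge0l scaler0 scale0r.
rewrite (ends_neq A1 _ _ (tprod_ends u)) /=.
have [Em|_] := eqVneq; last by rewrite scaler0 scale0r.
rewrite -tprod_mpath //=; have [->|_] := eqVneq (tprod u) 0; last by [].
by rewrite !scaler0.
Qed.

(** The idempotents on both sides cut [a] into blocks, each spanned according to (D3). Coefficients
    of vanishing products are then reset to 0, so that [c] lives on the simplices of the complex to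
    be built. *)
Lemma tprod_span p (a : A p) :
  exists2 c : {ffun 'I_p.+1 -> X} -> k,
    (forall v, tprod v = 0 -> c v = 0) & a = \sum_v c v *: tprod v.
Proof.
suff [c ->] : exists c : {ffun 'I_p.+1 -> X} -> k, a = \sum_v c v *: tprod v.
  exists (fun v => if tprod v == 0 then 0 else c v) => [v ->|]; first by rewrite eqxx.
  by apply: eq_bigr => v _; case: eqP => // ->; rewrite !scaler0.
have [p0|p0] := posnP p.
  subst p; have [f ->] := deg0_expand A1 a.
  exists (fun v => f (v ord0) : k).
  rewrite (reindex_onto (fun v : {ffun 'I_1 -> X} => v ord0)
    (fun x => [ffun=> x])) /=; last first.
    by move=> x _; rewrite ffunE.
  rewrite (eq_bigl predT) => [|v]; last by apply/eqP/ffunP => i; rewrite ffunE (ord1 i).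
  by apply: eq_bigr => v _; rewrite tprod0.
have [np|pn] := ltnP n p.
  by exists (fun=> 0); rewrite (An a np); under eq_bigr do rewrite scale0r; rewrite big1.
pose span (b : A p) := exists c : {ffun 'I_p.+1 -> X} -> k, b = \sum_v c v *: tprod v.
have span0 : span 0 by exists (fun=> 0); under eq_bigr do rewrite scale0r; rewrite big1.
have spanD b b' : span b -> span b' -> span (b + b').
  move=> [c ->] [c' ->]; exists (fun v => c v + c' v).
  by rewrite -big_split; apply: eq_bigr => v _; rewrite scalerDl.
rewrite -/(span a) (expandl A1 (add0n p) a).
apply: (big_ind span) => // x _.
rewrite (expandr A1 (addn0 p) (wedge A (add0n p) (dl x) a)).
apply: (big_ind span) => // y _.
have [|_ _ /(_ (wedge A (addn0 p) (wedge A (add0n p) (dl x) a) (dl y)))] := @A4 p x y.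
  by rewrite p0.
case; first by exists a.
move=> c _ ->; exists c; apply: eq_bigr => v _; by rewrite tprod_mpath.
Qed.

(* If the face vanished, [diff_tprod] would be a linear relation in which the
   tuple [v], having distinct entries, occurs with coefficient [(-1) ^+ j]. *)
Lemma tprod_neq0_face p (j : 'I_p.+2) (v : {ffun 'I_p.+2 -> X}) :
  tprod v != 0 -> tprod (fface j v) != 0.
Proof.
move=> nz; apply/eqP => fj0.
have := diff_tprod (fface j v); rewrite fj0 (lin0 (@diff_lin _ A p)).
move/esym/tprod_free/(_ v nz)/eqP; rewrite (big_pred1 j) ?signr_eq0 // => i /=.
apply/eqP/eqP => [|->] // /ffunP E; have v_inj := tprod_neq0_inj nz.
apply/eqP; apply: contraT => ij.
have [i' E' _] := unlift_some ij.
have := E i'; rewrite !ffunE -E' => /v_inj F.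
by have := neq_lift j i'; rewrite -F eqxx.
Qed.

Lemma tprod_neq0_fcomp q p (f : ordinj q p) (v : {ffun 'I_p.+1 -> X}) :
  tprod v != 0 -> tprod (fcomp v f) != 0.
Proof.
exact: (face_closed_ordinj (P := fun p v => tprod v != 0) (@tprod_neq0_face)).
Qed.

End TupleProducts.

(** * The complex of non-vanishing tuples *)

Section Reconstruction.
Variables (k : fieldType) (A : DGA k) (X : finType).
Variables (iota : {ffun X -> k^o} -> A 0) (n : nat).
Hypotheses (A1 : is_algebra_iso iota) (A2 : exterior A) (A3 : D2 iota).
Hypotheses (A4 : D3 iota n) (An : forall p (a : A p), (n < p)%N -> a = 0).

Local Notation tprod := (tprod iota).

Definition tuple_cell (p : nat) : finType := {v : {ffun 'I_p.+1 -> X} | tprod v != 0}.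

Definition tuple_cell_map q p (f : ordinj q p) (v : tuple_cell p) : tuple_cell q :=
  exist _ (fcomp (sval v) f) (tprod_neq0_fcomp A1 A2 A3 A4 An f (valP v)).

Lemma tuple_cell_map_id (p : Op (DeltaPlus n)) :
  tuple_cell_map (ordinj_id p) = id :> (tuple_cell p -> tuple_cell p).
Proof.
apply: functional_extensionality => v; apply/val_inj/ffunP => i.
by rewrite ffunE.
Qed.

Lemma tuple_cell_map_comp p q r (f : ordinj q p) (g : ordinj r q) :
  tuple_cell_map (ordinj_comp f g) = fun v => tuple_cell_map g (tuple_cell_map f v).
Proof.
apply: functional_extensionality => v; apply/val_inj/ffunP => i.
by rewrite !ffunE.
Qed.

Definition tuple_cell_functor : Functor (Op (DeltaPlus n)) FinSetCat :=
  @MkFunctor (Op (DeltaPlus n)) FinSetCat (fun p => tuple_cell p)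
    (fun p q (f : ordinj q p) => @tuple_cell_map q p f)
    tuple_cell_map_id (fun p q r g f => tuple_cell_map_comp f g).

(** Vertices of the complex are one-entry tuples rather than points of [X]; the index [j] reads off
    the point. *)
Lemma tuple_cell_vertE (p : 'I_n.+1) (v : cells tuple_cell_functor p) i j :
  sval (vert v i : tuple_cell 0) j = sval (v : tuple_cell p) i.
Proof. by rewrite ffunE /= ffunE. Qed.

Lemma tuple_cell_vert_inj (p : 'I_n.+1) : injective (@vert n tuple_cell_functor p).
Proof.
move=> u v E; apply/val_inj/ffunP => i.
by rewrite -(tuple_cell_vertE u i ord0) -(tuple_cell_vertE v i ord0) E.
Qed.

Lemma tuple_cell_vert_distinct (p : 'I_n.+1) (v : cells tuple_cell_functor p) :
  (0 < p)%N -> injective (vert v).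
Proof.
move=> _ i j E; apply: (tprod_neq0_inj A1 A2 A3 (valP (v : tuple_cell p))).
by rewrite -[RHS](tuple_cell_vertE v j ord0) -E tuple_cell_vertE.
Qed.

Definition tuple_complex : NSSet n := MkNSSet tuple_cell_vert_inj tuple_cell_vert_distinct.

Definition vtuple p (s : simp tuple_complex p) : {ffun 'I_p.+1 -> X} :=
  sval (projT2 s : tuple_cell p).

Lemma vtuple_neq0 p (s : simp tuple_complex p) : tprod (vtuple s) != 0.
Proof. exact: valP (projT2 s : tuple_cell p). Qed.

Lemma svert_vtuple p (s : simp tuple_complex p) i j :
  sval (svert s i : tuple_cell 0) j = vtuple s i.
Proof. exact: tuple_cell_vertE. Qed.

Lemma vtuple_inj p : injective (@vtuple p).
Proof.
move=> s t E; apply: simp_eq => i; apply/val_inj/ffunP => j.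
by rewrite [LHS](svert_vtuple s i j) E [RHS](svert_vtuple t i j).
Qed.

Lemma vtuple_restr q p (f : ordinj q p) (s : simp tuple_complex p) :
  vtuple (restr f s) = fcomp (vtuple s) f.
Proof.
apply/ffunP => i.
by rewrite [RHS]ffunE -(svert_vtuple (restr f s) i ord0) svert_restr svert_vtuple.
Qed.

Lemma vtuple_surj p v : tprod v != 0 -> exists s : simp tuple_complex p, vtuple s = v.
Proof.
move=> nz; have pn : (p <= n)%N.
  by rewrite leqNgt; apply: contraNN nz => np; apply/eqP; apply: An.
pose h : dim_ok n p := exist (fun _ : unit => (p <= n)%N) tt pn.
pose v' : tuple_cell p := exist _ v nz.
by exists (existT (fun h => cells tuple_complex (dim_ord h) : Type) h v').
Qed.

(** Passes from formulas indexed by all tuples to the basis of cochains: [vtuple] is injective, with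
    image the non-vanishing tuples. *)
Lemma sum_simp p (F : {ffun 'I_p.+1 -> X} -> A p) :
  (forall v, tprod v = 0 -> F v = 0) ->
  \sum_v F v = \sum_(s : simp tuple_complex p) F (vtuple s).
Proof.
move=> F0; rewrite (bigID (fun v => v \in codom (@vtuple p))) /=.
rewrite [X in _ + X]big1 ?addr0 => [|v vs].
  rewrite -(big_image _ _ _ xpredT) /= big_uniq //=.
  by rewrite map_inj_uniq ?enum_uniq //; apply: vtuple_inj.
apply: F0; apply/eqP; apply: contraNT vs => /vtuple_surj[s <-].
exact: codom_f.
Qed.

Definition realize p (a : Om k tuple_complex p) : A p :=
  \sum_s (a s : k) *: tprod (vtuple s).

Lemma realize_lin p : linear (@realize p).
Proof.
move=> c a b; rewrite /realize scaler_sumr -big_split.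
by apply: eq_bigr => s _; rewrite !ffunE scalerDl scalerA.
Qed.

Lemma realize_inj p : injective (@realize p).
Proof.
move=> a b /eqP; rewrite -subr_eq0 -(linB (@realize_lin p)) => /eqP E.
apply/eqP; rewrite -subr_eq0; apply/eqP/ffunP => s; rewrite [RHS]ffunE.
move: (a - b) E => {a b} a E.
(* Extension of [a] by zero to all tuples, so that [tprod_free] applies. *)
pose c (v : {ffun 'I_p.+1 -> X}) : k :=
  if [pick s | vtuple s == v] is Some s then a s else 0.
have cE t : c (vtuple t) = a t.
  rewrite /c; case: pickP => [t' /eqP/vtuple_inj->|/(_ t)] //; by rewrite eqxx.
rewrite -[LHS]cE.
apply: (tprod_free A1 A4 An _ (vtuple_neq0 s)).
rewrite sum_simp => [|v ->]; last by rewrite scaler0.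
by rewrite -[RHS]E; apply: eq_bigr => t _; rewrite cE.
Qed.

Lemma realize_surj p (b : A p) : exists a, realize a = b.
Proof.
have [c c0 ->] := tprod_span A1 A4 An b.
exists [ffun s => c (vtuple s)].
rewrite sum_simp => [|v ->]; last by rewrite scaler0.
by apply: eq_bigr => s _; rewrite ffunE.
Qed.

Lemma realize1 : realize (Om_one k tuple_complex) = dga1 A.
Proof.
rewrite -(sum_delta A1) /realize.
under eq_bigr => s _ do rewrite Om_oneE scale1r.
rewrite -(sum_simp (fun v Z => Z)).
rewrite (reindex_onto (fun x => [ffun=> x])
  (fun v : {ffun 'I_1 -> X} => v ord0)) /=; last first.
  by move=> v _; apply/ffunP => i; rewrite ffunE (ord1 i).
rewrite (eq_bigl predT) => [|x]; last by rewrite ffunE eqxx.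
by apply: eq_bigr => x _; rewrite tprod0 ffunE.
Qed.

(** After [diff_tprod], compare coefficients at a simplex [u]: for each position [j] the only [s]
    contributing is the [j]-th face of [u]. *)
Lemma realize_diff p (a : Om k tuple_complex p) :
  realize (Om_diff a) = diff A (realize a).
Proof.
rewrite /realize diff_sum.
under [RHS]eq_bigr => s _.
  rewrite (linZ (@diff_lin _ A p)) (diff_tprod A1 A2 A3).
  rewrite sum_simp; last by move=> v ->; rewrite scaler0.
  rewrite scaler_sumr; under eq_bigr => u _ do rewrite scalerA.
  over.
rewrite exchange_big /=; apply: eq_bigr => u _; rewrite -scaler_suml.
congr (_ *: _); rewrite Om_diffE.
under [RHS]eq_bigr => s _ do rewrite mulr_sumr big_mkcond.
rewrite exchange_big /=; apply: eq_bigr => j _.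
rewrite -big_mkcond (big_pred1 (face (S := tuple_complex) j u)) 1?mulrC // => s /=.
have -> : fface j (vtuple u) = vtuple (face (S := tuple_complex) j u).
  by rewrite vtuple_restr.
by rewrite (inj_eq (@vtuple_inj p)) eq_sym.
Qed.

(** The sum has at most one term, the concatenation of [s] and [t]. If their ends do not match, both
    sides are zero; otherwise the left side is the product of the glued tuple, which is a simplex
    exactly when that product is non-zero. *)
Lemma tprod_wedge p q r (h : (p + q)%N = r)
    (s : simp tuple_complex p) (t : simp tuple_complex q) :
  wedge A h (tprod (vtuple s)) (tprod (vtuple t))
  = \sum_(u : simp tuple_complex r | (restr (front (leq_addr_eq h)) u == s)
                            && (restr (back (leq_addl_eq h)) u == t))
      tprod (vtuple u).
Proof.
set F := front _; set B := back _.
have FB : F ord_max = B ord0 by apply: val_inj => /=; lia.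
have [E|ne] := eqVneq (vtuple s ord_max) (vtuple t ord0); last first.
  rewrite big_pred0 => [|u].
    exact: (wedge_mismatch A1 h (tprod_ends A1 _) (tprod_starts A1 _) ne).
  apply: contraNF ne => /andP[/eqP <- /eqP <-].
  by rewrite !vtuple_restr !ffunE FB.
(* The common vertex, at position [p], is read from [s]; by [E] it is also the first entry of
   [t]. *)
pose w m := if (m <= p)%N then vtuple s (inord m) else vtuple t (inord (m - p)).
have ws : tprod (vtuple s) = pprod iota w p.
  by apply: eq_pprod => i ip; rewrite /w ip.
have wt : tprod (vtuple t) = pprod iota (fun i => w (p + i)%N) q.
  apply: eq_pprod => i iq; rewrite /w (_ : (p + i <= p)%N = (i == 0)%N) ?addKn; last by lia.
  case: eqP => // ->; rewrite addn0 (_ : inord p = ord_max) ?E.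
    by congr (vtuple t _); apply: val_inj; rewrite /= inordK.
  by apply: val_inj; rewrite /= inordK.
rewrite ws wt (pprod_cat A1).
have key u : (restr F u == s) && (restr B u == t)
           = (vtuple u == [ffun i : 'I_r.+1 => w i]).
  apply/andP/eqP => [[/eqP es /eqP et]|Eu].
    apply/ffunP => m; rewrite [RHS]ffunE /w -es -et !vtuple_restr; case: leqP => mp;
      rewrite ffunE; congr (vtuple u _); apply: val_inj; rewrite /= inordK //;
      by have := ltn_ord m; lia.
  split; apply/eqP/vtuple_inj/ffunP => m; rewrite vtuple_restr ffunE Eu ffunE /=.
    by rewrite /w leq_ord inord_val.
  have mE : (m + (r - q) = p + m)%N by have := ltn_ord m; lia.
  rewrite mE /w (_ : (p + m <= p)%N = (m == 0 :> nat)%N) ?addKn ?inord_val; last by lia.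
  case: (eqVneq (m : nat) 0%N) => // m0.
  rewrite (_ : inord (p + m) = ord_max); last by apply: val_inj; rewrite /= m0 addn0 inordK.
  by rewrite E; congr (vtuple t _); apply: val_inj; rewrite /= m0.
rewrite (eq_bigl _ _ key).
have wE : tprod [ffun i : 'I_r.+1 => w i] = pprod iota w r.
  by apply: eq_pprod => i ir; rewrite ffunE inordK.
have [Z|] := eqVneq (pprod iota w r) 0.
  rewrite Z big_pred0 // => u; apply: contraNF (vtuple_neq0 u) => /eqP->.
  by rewrite wE Z.
rewrite -wE => /vtuple_surj[u0 <-].
by rewrite (big_pred1 u0) // => u; rewrite (inj_eq (@vtuple_inj r)).
Qed.

Lemma realizeM p q r (h : (p + q)%N = r) a b :
  realize (Om_wedge h a b) = wedge A h (realize a) (realize b).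
Proof.
rewrite {2}/realize wedge_suml.
under [RHS]eq_bigr => s _.
  rewrite wedgeZl /realize wedge_sumr scaler_sumr.
  under eq_bigr => t _ do
    rewrite wedgeZr tprod_wedge scalerA scaler_sumr big_mkcond /=.
  rewrite exchange_big /=; over.
rewrite exchange_big /=; apply: eq_bigr => u _; rewrite Om_wedgeE.
set s0 := restr _ u; set t0 := restr _ u.
rewrite (bigD1 s0) //= (bigD1 t0) //= !eqxx /= -addrA big1 ?add0r => [|t tt0]; last first.
  by rewrite eq_sym (negPf tt0).
rewrite big1 ?addr0 // => s ss0; rewrite big1 // => t _.
by rewrite eq_sym (negPf ss0).
Qed.

Definition realization : DGAHom (Omega_dga k tuple_complex) A :=
  @MkDGAHom k (Omega_dga k tuple_complex) A realize realize_lin realize1 realizeM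
    realize_diff.

Lemma realization_iso : @is_iso (DGACat k) (Omega_dga k tuple_complex) A realization.
Proof.
by apply: bijective_dgahom => [p|p b]; [apply: realize_inj|apply: realize_surj].
Qed.

End Reconstruction.

(** * The cochain algebra of a non-singular complex *)

Section Vertices.
Variables (k : fieldType) (n : nat) (S : NSSet n).

(** Here vertices are elements of [simp S 0], not of [cells S ord0]: forms of degree 0 are functions
    on [simp S 0], which serves as the set [X] of (D1), with the identity as [vertex_iota]. *)
Definition vtx p (u : simp S p) : {ffun 'I_p.+1 -> simp S 0} :=
  [ffun i => restr (vertex_map i) u].

Lemma svert_vtx p (u : simp S p) i j : svert (vtx u i) j = svert u i.
Proof. by rewrite [vtx u i]ffunE svert_restr (ord1 j). Qed.

Lemma vtx_inj p : injective (@vtx p).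
Proof. by move=> u v E; apply: simp_eq => i; rewrite -(svert_vtx u i ord0) E svert_vtx. Qed.

Lemma vtx_distinct p (u : simp S p) : injective (vtx u).
Proof.
move=> i j E; apply: (svert_distinct (s := u)).
by rewrite -(svert_vtx u i ord0) E svert_vtx.
Qed.

Lemma vtx_restr q p (f : ordinj q p) (u : simp S p) i : vtx (restr f u) i = vtx u (f i).
Proof. by apply: simp_eq => j; rewrite !svert_vtx svert_restr. Qed.

Lemma simp_vtx p (u v : simp S p) : vtx u =1 vtx v -> u = v.
Proof. by move=> E; apply/vtx_inj/ffunP. Qed.

Lemma simp0_vtx (s : simp S 0) i : vtx s i = s.
Proof. by apply: simp_eq => j; rewrite svert_vtx (ord1 i) (ord1 j). Qed.

Lemma eq_vtx0 (s t : simp S 0) : (vtx s ord0 = vtx t ord0) -> s = t.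
Proof. by rewrite !simp0_vtx. Qed.

Definition vertex_iota : {ffun simp S 0 -> k^o} -> Omega_dga k S 0 := fun f => f.

Lemma vertex_iota_iso : is_algebra_iso vertex_iota.
Proof.
split=> //; first by exists vertex_iota.
  by apply/ffunP => s; rewrite ffunE Om_oneE.
move=> f g; apply/ffunP => s; rewrite ffunE Om_wedgeE.
by congr (f _ * g _); apply: eq_vtx0; rewrite !vtx_restr; congr (vtx s _);
  apply: val_inj.
Qed.

Lemma deltaE x s : delta vertex_iota x s = (s == x)%:R.
Proof. by rewrite ffunE. Qed.

Lemma wedge_deltal p (h : (0 + p)%N = p) x (a : Omega_dga k S p) u :
  wedge (Omega_dga k S) h (delta vertex_iota x) a u = (vtx u ord0 == x)%:R * (a u : k).
Proof.
rewrite [LHS]Om_wedgeE [X in X * _ = _]deltaE; congr ((_ == _)%:R * a _).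
  apply: eq_vtx0; rewrite vtx_restr simp0_vtx; congr (vtx u _); exact: val_inj.
by apply: simp_vtx => i; rewrite vtx_restr; congr (vtx u _); apply: val_inj => /=; lia.
Qed.

Lemma wedge_deltar p (h : (p + 0)%N = p) x (a : Omega_dga k S p) u :
  wedge (Omega_dga k S) h a (delta vertex_iota x) u = (a u : k) * (vtx u ord_max == x)%:R.
Proof.
rewrite [LHS]Om_wedgeE [X in _ * X = _]deltaE.
congr (_ * _); [congr (a _)|congr ((_ == _)%:R)].
  by apply: simp_vtx => i; rewrite vtx_restr; congr (vtx u _); apply: val_inj.
by apply: eq_vtx0; rewrite vtx_restr simp0_vtx; congr (vtx u _); apply: val_inj => /=; lia.
Qed.

Lemma face_edge (e : simp S 1) (j : 'I_2) : face j e = vtx e (rev_ord j).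
Proof.
apply: eq_vtx0; rewrite /face vtx_restr simp0_vtx; congr (vtx e _); apply: val_inj.
by case: j => [[|[|]]].
Qed.

Lemma block_Omega p x y (a : Omega_dga k S p) :
  block vertex_iota x y a <-> forall u, a u != 0 -> vtx u ord0 = x /\ vtx u ord_max = y.
Proof.
split=> [[b ->] u|E].
  rewrite wedge_deltar wedge_deltal.
  have [->|_] := eqVneq (vtx u ord0) x; last by rewrite !mul0r eqxx.
  by have [->|_] := eqVneq (vtx u ord_max) y; last by rewrite mulr0 eqxx.
exists a; apply/ffunP => u; rewrite wedge_deltar wedge_deltal.
have [->|/E[-> ->]] := eqVneq (a u) 0; first by rewrite mulr0 mul0r.
by rewrite !eqxx mul1r mulr1.
Qed.

End Vertices.

Arguments vertex_iota k {n} S f.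

(** * Images of path products under a morphism *)

Section PathEvaluation.
Variables (k : fieldType) (n : nat) (S T : NSSet n).
Variables (h : DGAHom (Omega_dga k T) (Omega_dga k S)) (gam : simp S 0 -> simp T 0).
Hypothesis h_gam : forall b s, h 0 b s = b (gam s).

(** On [e] the value is [[gam e_0 = x] ([gam e_1 = y] - [gam e_0 = y])], and [x != y] kills the
    subtracted bracket. *)
Lemma hom_omega x y (e : simp S 1) : x != y ->
  h 1 (omega (vertex_iota k T) x y) e
  = ((gam (vtx e ord0) == x) && (gam (vtx e ord_max) == y))%:R.
Proof.
move=> xy; rewrite /omega (negPf xy) dgahomM dgahomd [LHS]Om_wedgeE Om_diffE.
rewrite big_ord_recl big_ord1 expr0 expr1 mul1r mulN1r !h_gam !deltaE !face_edge.
have -> : rev_ord (ord0 : 'I_2) = ord_max by apply: val_inj.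
have -> : rev_ord (lift ord0 ord0 : 'I_2) = ord0 by apply: val_inj.
have -> : restr (back (leq_addl_eq (add0n 1))) e = e.
  by apply: simp_vtx => i; rewrite vtx_restr; congr (vtx e _); apply: val_inj; exact: addn0.
have -> : restr (front (leq_addr_eq (add0n 1))) e = vtx e ord0.
  by apply: eq_vtx0; rewrite vtx_restr simp0_vtx; congr (vtx e _); apply: val_inj.
case: eqP => [->|_]; last by rewrite mul0r.
by rewrite (negPf xy) subr0 mul1r.
Qed.

(** The product at [u] multiplies the values of [hom_omega] on the consecutive edges of [u]. It
    serves twice: for the identity, to compute in [Omega_dga k S], and for arbitrary [h], to detect
    simplices of [T]. *)
Lemma hom_pprod (w : nat -> simp T 0) p (u : simp S p) :
  (forall i, (i < p)%N -> w i != w i.+1) ->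
  h p (pprod (vertex_iota k T) w p) u
  = [forall i : 'I_p.+1, gam (vtx u i) == w i]%:R.
Proof.
elim: p u => [|p IH] u wd.
  rewrite /= h_gam deltaE; congr (_%:R); congr nat_of_bool.
  apply/idP/forallP => [E i|/(_ ord0)].
    by rewrite (ord1 i) simp0_vtx.
  by rewrite simp0_vtx.
rewrite /= (dgahomM h (addn1 p)) [LHS]Om_wedgeE IH; last first.
  by move=> i ip; apply: wd; rewrite ltnW.
rewrite hom_omega ?wd // -natrM mulnb; congr (_%:R); congr nat_of_bool.
apply/andP/forallP => [[/forallP E1 /andP[_ E3]] i|E].
  have [ip|ip] := ltnP i p.+1.
    have := E1 (Ordinal ip); rewrite vtx_restr /=; congr (gam (vtx u _) == _).
    exact: val_inj.
  have ip1 : i = p.+1 :> nat by apply/eqP; rewrite eqn_leq ip -ltnS ltn_ord.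
  move: E3; rewrite vtx_restr ip1; congr (gam (vtx u _) == _).
  by apply: val_inj; rewrite /= ip1; lia.
split.
  by apply/forallP => i; rewrite vtx_restr; have := E (front (leq_addr_eq (addn1 p)) i).
have bE m : back (leq_addl_eq (addn1 p)) m = (m + p)%N :> nat by rewrite /= subn1.
by apply/andP; split; rewrite vtx_restr;
  [have := E (back (leq_addl_eq (addn1 p)) ord0)
  |have := E (back (leq_addl_eq (addn1 p)) ord_max)]; rewrite bE.
Qed.

End PathEvaluation.

Section OmegaInDGhat.
Variables (k : fieldType) (n : nat) (S : NSSet n).

Local Notation iotaS := (vertex_iota k S).

(** With a consecutive repetition in [v] both sides are zero, simplices having distinct vertices;
    otherwise this is [hom_pprod] for the identity morphism. *)
Lemma tprod_Omega p (v : {ffun 'I_p.+1 -> simp S 0}) u :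
  (tprod iotaS v : Om k S p) u = (vtx u == v)%:R.
Proof.
case: (boolP [exists i : 'I_p, v (inord i) == v (inord i.+1)]) => [/existsP[i E]|ne].
  have /eqP -> : tprod iotaS v == 0.
    apply: contraT => nz; have := pprod_neq0_omega nz (ltn_ord i).
    by rewrite (eqP E) omegaxx eqxx.
  rewrite ffunE; case: eqP => // uv; have ip := ltn_ord i.
  move: E; rewrite -uv => /eqP/vtx_distinct/(congr1 val) /=.
  by rewrite !inordK //; [lia | rewrite ltnW].
rewrite -[tprod _ _]/(dgahom_id (Omega_dga k S) p (tprod iotaS v)).
rewrite (@hom_pprod k n S S _ id) => [|//|i ip]; last first.
  by move: ne; rewrite negb_exists => /forallP/(_ (Ordinal ip)).
congr (_%:R); congr nat_of_bool; apply/forallP/eqP => [E|<- i].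
  by apply/ffunP => i; rewrite -[v i]/(v i) (eqP (E i)) inord_val.
by rewrite inord_val.
Qed.

Lemma tprod_Omega_neq0 p (v : {ffun 'I_p.+1 -> simp S 0}) :
  tprod (iotaS) v != 0 -> exists u, vtx u = v.
Proof.
move=> nz; apply/exists_eqP; apply: contraT; rewrite negb_exists => /forallP none.
case/eqP: nz; apply/ffunP => u; rewrite tprod_Omega (negPf (none u)).
by rewrite ffunE.
Qed.

Lemma rho_tprod p (u : simp S p) : rho k u = tprod iotaS (vtx u).
Proof.
apply/ffunP => t; rewrite tprod_Omega ffunE.
by rewrite (inj_eq (@vtx_inj n S p)).
Qed.

(** Each [rho k u] is a path product. On an edge it has the form [delta d(delta)], and in higher
    degree its scalar coefficient is put into the first factor. *)
Lemma Omega_exterior : exterior (Omega_dga k S).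
Proof.
split=> [a|p p0 a].
  pose f (e : simp S 1) : Omega_dga k S 0 := (a e : k) *: delta iotaS (vtx e ord0).
  pose g (e : simp S 1) : Omega_dga k S 0 := delta iotaS (vtx e ord_max).
  exists #|simp S 1|, (fun i => f (enum_val i)), (fun i => g (enum_val i)).
  rewrite -(big_enum_val (fun e => wedge (Omega_dga k S) (add0n 1) (f e) (diff _ (g e)))).
  rewrite [LHS](rho_expand a); apply: eq_big => // e _; rewrite /f wedgeZl; congr (_ *: _).
  have e01 : vtx e ord0 != vtx e ord_max.
    by apply/eqP => /vtx_distinct/(congr1 val).
  rewrite rho_tprod (tprod_mpath (vertex_iota_iso k S)) // /mpath wprod1.
  rewrite (_ : inord 0 = ord0); last by apply: val_inj; rewrite /= inordK.
  rewrite (_ : inord 1 = ord_max); last by apply: val_inj; rewrite /= inordK.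
  by rewrite /omega (negPf e01).
pose f (u : simp S p) i : Omega_dga k S 1 :=
  let b := omega iotaS (vtx u (inord i)) (vtx u (inord i.+1)) in
  if i == 0%N then (a u : k) *: b else b.
exists #|simp S p|, (fun i => f (enum_val i)).
rewrite -(big_enum_val (fun u => wprod (f u) p)).
rewrite [LHS](rho_expand a); apply: eq_big => // u _.
by rewrite /f wprod_scale // rho_tprod (tprod_mpath (vertex_iota_iso k S)).
Qed.

Lemma block_rho p x y (u : simp S p) : vtx u ord0 = x -> vtx u ord_max = y ->
  block iotaS x y (rho k u : Omega_dga k S p).
Proof.
move=> ux uy; apply/block_Omega => t; rewrite ffunE.
by have [->|_] := eqVneq t u; rewrite ?eqxx.
Qed.

Lemma block_zero_rho p x y (u : simp S p) : block_zero iotaS p x y ->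
  vtx u ord0 = x -> vtx u ord_max = y -> False.
Proof.
move=> Z ux uy; have /ffunP/(_ u) := Z _ (block_rho ux uy).
by rewrite !ffunE eqxx => /eqP; rewrite oner_eq0.
Qed.

Lemma edge_homo p (i j : 'I_p.+1) (ij : (i < j)%N) (a b : 'I_2) : (a <= b)%N ->
  ((if a == ord0 then i else j) <= (if b == ord0 then i else j))%N.
Proof.
case: a b => [[|[|a]] ?] [[|[|b]] ?] //= _; exact: ltnW.
Qed.

Lemma edge_inj p (i j : 'I_p.+1) (ij : (i < j)%N) : injective (OrdMap (edge_homo ij)).
Proof.
move=> a b E; apply: val_inj; move/(congr1 val): E => /=.
by case: a b => [[|[|a]] ?] [[|[|b]] ?] //= E; move: ij; rewrite E ltnn.
Qed.

Definition edge p (i j : 'I_p.+1) (ij : (i < j)%N) : ordinj 1 p := OrdInj (@edge_inj p i j ij).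

Lemma block1_nonzero p (u : simp S p) (i j : 'I_p.+1) : (i < j)%N ->
  ~ block_zero iotaS 1 (vtx u i) (vtx u j).
Proof.
by move=> ij /(block_zero_rho (u := restr (edge ij) u)); apply; rewrite vtx_restr.
Qed.

(** A simplex from [x] to [y] has the edge joining its first and last vertices as a face, which
    makes the block of degree 1 non-zero. *)
Lemma Omega_D2 : D2 iotaS.
Proof.
move=> p x y p1 Z a /block_Omega E; apply/ffunP => u; rewrite [RHS]ffunE.
have [//|/E[ux uy]] := eqVneq (a u) 0.
have p0 : ((ord0 : 'I_p.+1) < (ord_max : 'I_p.+1))%N by rewrite /= ltnW.
by case: (block1_nonzero (u := u) p0); rewrite ux uy.
Qed.

(** By [tprod_Omega] the non-zero path products are the elements [rho k u], the standard basis of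
    the cochains; consecutive vertices of [u] are joined by edges, so its tuple is a path. *)
Lemma Omega_D3 : D3 iotaS n.
Proof.
move=> p x y /andP[p0 _]; have mE := tprod_mpath (vertex_iota_iso k S) _ p0.
split=> [v [[v0 vp _] _]|c c0 Z v|a /block_Omega E].
- apply/block_Omega => u; rewrite -mE tprod_Omega.
  by have [->|_] := eqVneq (vtx u) v; rewrite ?eqxx.
- have [m0|] := eqVneq (mpath iotaS v) 0; first by apply: c0 => -[].
  rewrite -mE => nz.
  have [u uv] := tprod_Omega_neq0 nz.
  move/ffunP/(_ u): Z; rewrite sum_ffunE (bigD1 v) //= ffunE -mE tprod_Omega uv eqxx.
  rewrite big1 => [|v' v'v].
    by rewrite addr0 ffunE [X in X = _]mulr1.
  by rewrite ffunE -mE tprod_Omega uv eq_sym (negPf v'v) scaler0.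
pose c (v : {ffun 'I_p.+1 -> simp S 0}) : k :=
  if [pick u | vtx u == v] is Some u then a u else 0.
have cE u : c (vtx u) = a u.
  rewrite /c; case: pickP => [t /eqP/vtx_inj->|/(_ u)] //; by rewrite eqxx.
exists c => [v nJ|].
  rewrite /c; case: pickP => [u /eqP uv|//].
  have [//|nz] := eqVneq (a u) 0; case: nJ; have [ux uy] := E u nz; split.
    split; rewrite -uv // => i ip.
    have lt : ((inord i : 'I_p.+1) < (inord i.+1 : 'I_p.+1))%N.
      by rewrite !inordK // ltnW.
    split; last exact: block1_nonzero.
    by move/vtx_distinct => E'; rewrite E' ltnn in lt.
  rewrite -mE => /ffunP/(_ u); rewrite tprod_Omega uv eqxx ffunE => /eqP.
  by rewrite oner_eq0.
apply/ffunP => u; rewrite sum_ffunE (bigD1 (vtx u)) //= ffunE -mE tprod_Omega eqxx cE.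
rewrite big1 => [|v vu]; first by rewrite addr0 [RHS]mulr1.
by rewrite ffunE -mE tprod_Omega eq_sym (negPf vu) scaler0.
Qed.

Lemma Omega_in_DGhat : in_DGhat (Omega_obj k S).
Proof.
exists (simp S 0), iotaS; split; [|exact: Omega_D2|exact: Omega_D3].
by split; [apply: vertex_iota_iso|apply: Omega_exterior].
Qed.

End OmegaInDGhat.

(** * Invariance under isomorphism *)

Section Transport.
Variables (k : fieldType) (A B : DGA k) (f : DGAHom A B) (g : DGAHom B A).
Hypotheses (fK : forall p, cancel (f p) (g p)) (gK : forall p, cancel (g p) (f p)).
Variables (X : finType) (iota : {ffun X -> k^o} -> A 0).

Let iota' (u : {ffun X -> k^o}) : B 0 := f 0 (iota u).

Lemma dgahom_wprod w p : f p (wprod w p) = wprod (fun i => f 1 (w i)) p.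
Proof.
elim: p => [|p IH] /=; first exact: dgahom1.
by rewrite (dgahomM f (addn1 p)) IH.
Qed.

Lemma dgahom_omega x y : f 1 (omega iota x y) = omega iota' x y.
Proof.
rewrite /omega; case: eqP => _; first exact: (lin0 (dgahom_lin f (p := 1))).
by rewrite (dgahomM f (add0n 1)) dgahomd.
Qed.

Lemma dgahom_mpath p (v : {ffun 'I_p.+1 -> X}) : f p (mpath iota v) = mpath iota' v.
Proof.
rewrite /mpath dgahom_wprod; congr (wprod _ p).
by apply: functional_extensionality => i; apply: dgahom_omega.
Qed.

Lemma dgahom_block p x y (b : B p) : block iota' x y b <-> block iota x y (g p b).
Proof.
split=> [[u ->]|[u E]].
  exists (g p u); rewrite (dgahomM g (addn0 p)) (dgahomM g (add0n p)).
  by rewrite /delta /iota' !fK.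
exists (f p u); rewrite -[LHS]gK E (dgahomM f (addn0 p)) (dgahomM f (add0n p)).
by [].
Qed.

Lemma dgahom_block_zero p x y : block_zero iota' p x y <-> block_zero iota p x y.
Proof.
split=> Z a.
  move=> Ba; rewrite -[LHS]fK (Z (f p a)) ?(lin0 (dgahom_lin g (p := p))) //.
  by apply/dgahom_block; rewrite fK.
by move/dgahom_block/Z => E; rewrite -[LHS]gK E (lin0 (dgahom_lin f (p := p))).
Qed.

Lemma dgahom_is_path p x y (v : {ffun 'I_p.+1 -> X}) :
  is_path iota' x y v <-> is_path iota x y v.
Proof.
by split=> -[? ? E]; split=> // i /E[? nZ]; split=> // /dgahom_block_zero.
Qed.

(** An essential image is closed under isomorphism, so the conditions must be as well; they are
    carried along [f] and checked through the inverse [g]. *)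
Lemma in_DGhat_transport n : [/\ D1 iota, D2 iota & D3 iota n] ->
  [/\ D1 iota', D2 iota' & D3 iota' n].
Proof.
case=> -[[lin bij one mul] [E1 E2]] H2 H3.
have flin p := dgahom_lin f (p := p).
split.
- split.
    split.
    + by move=> c u v; rewrite /iota' lin flin.
    + by apply: (bij_comp (f := f 0)) => //; exists (g 0%N).
    + by rewrite /iota' one dgahom1.
    + by move=> u v; rewrite /iota' mul (dgahomM f (addn0 0)).
  split=> [b|p p0 b].
    have [N [u [v E]]] := E1 (g _ b).
    exists N, (fun i => f _ (u i)), (fun i => f _ (v i)).
    rewrite -[LHS]gK E (lin_sum (flin 1%N)); apply: eq_bigr => i _.
    by rewrite (dgahomM f (add0n 1)) dgahomd.
  have [N [u E]] := E2 p p0 (g _ b).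
  exists N, (fun i j => f _ (u i j)).
  by rewrite -[LHS]gK E (lin_sum (flin p)); apply: eq_bigr => i _; rewrite dgahom_wprod.
- by move=> p x y p1 /dgahom_block_zero Z; apply/dgahom_block_zero/H2.
move=> p x y /H3-/(_ x y)[J1 J2 J3].
have mz (v : {ffun 'I_p.+1 -> X}) : mpath iota' v <> 0 <-> mpath iota v <> 0.
  rewrite -dgahom_mpath; split=> nz E; apply: nz; first by rewrite E (lin0 (flin p)).
  by rewrite -[LHS](@fK p) E (lin0 (dgahom_lin g (p := p))).
split=> [v [/dgahom_is_path vp /mz nz]|c c0 Z|b /dgahom_block/J3[c c0 E]].
- by apply/dgahom_block; rewrite -dgahom_mpath fK; apply: J1.
- apply: J2 => [v nJ|].
    by apply: c0 => -[/dgahom_is_path ? /mz ?]; apply: nJ.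
  rewrite -[RHS](lin0 (dgahom_lin g (p := p))) -Z (lin_sum (dgahom_lin g (p := p))).
  by apply: eq_bigr => v _; rewrite (linZ (dgahom_lin g (p := p))) -dgahom_mpath fK.
exists c => [v nJ|].
  by apply: c0 => -[/dgahom_is_path ? /mz ?]; apply: nJ.
rewrite -[LHS]gK E (lin_sum (flin p)); apply: eq_bigr => v _.
by rewrite (linZ (flin p)) dgahom_mpath.
Qed.

End Transport.

(** * Cells of completions *)

Section CompletedCells.
Variables (n : nat).

(** A cell of the completion is treated as a simplex with possibly repeated vertices. *)
Definition lvert (S : NSSet n) (p : 'I_n.+1) (x : Lcell (underlying S) p)
    (i : 'I_p.+1) : cells S ord0 :=
  vert (S := S) (projT2 x).2 ((projT2 x).1 i).

Lemma lvert_Lact (S : NSSet n) (p q : 'I_n.+1) (f : ordmap q p)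
    (x : Lcell (underlying S) p) i :
  lvert (Lact f x) i = lvert x (f i).
Proof.
case: x => r [pi s].
have mf := @vert_fmap n S r (fac_ord (ordmap_comp pi f))
  (fac_mono (epi_mono (ordmap_comp pi f))) s.
rewrite [LHS](mf (fac_epi (epi_mono (ordmap_comp pi f)) i)).
by congr (vert (S := S) s _); apply: facE.
Qed.

(** A monotone map jumping by two or more would skip a value. *)
Lemma ordsurj_step (p q m : nat) (e : ordsurj p q) : (m < p)%N ->
  e (inord m.+1) = (e (inord m) + (e (inord m) != e (inord m.+1)))%N :> nat.
Proof.
move=> mp; case: eqVneq => [->|ne]; first by rewrite addn0.
have lt : (e (inord m) < e (inord m.+1))%N.
  by rewrite ltn_neqAle ne; apply: om_homo; rewrite !inordK // ltnW.
apply/eqP; rewrite addn1 eqn_leq lt andbT.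
have [i Ei] := os_surj e (inord (e (inord m)).+1).
have Ev : e i = (e (inord m)).+1 :> nat.
  by rewrite Ei inordK // (leq_ltn_trans lt).
rewrite -Ev; apply: om_homo; rewrite inordK // ltnNge; apply/negP => im.
have : (e i <= e (inord m))%N by apply: om_homo; rewrite inordK // ltnW.
by rewrite Ev ltnn.
Qed.

(** By [ordsurj_step] the value at [i] counts the changes before [i], which depend only on the
    kernel. *)
Lemma ordsurj_ker (p q q' : nat) (e : ordsurj p q) (e' : ordsurj p q') :
  (forall i j, (e i == e j) = (e' i == e' j)) -> forall i, e i = e' i :> nat.
Proof.
move=> ker i; rewrite -(inord_val i); have := ltn_ord i; rewrite ltnS.
elim: (i : nat) => [_|m IH mp].
  have e0 r (f : ordsurj p r) : f (inord 0) = 0%N :> nat.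
    have [j Ej] := os_surj f ord0; apply/eqP; rewrite -leqn0.
    rewrite -[X in (_ <= X)%N]/(nat_of_ord (@ord0 r)) -Ej.
    by apply: om_homo; rewrite inordK.
  by rewrite !e0.
by rewrite !ordsurj_step // IH ?ker // ltnW.
Qed.

Lemma vert_distinct (S : NSSet n) (p : 'I_n.+1) (s : cells S p) : injective (vert s).
Proof.
have [p0|] := posnP p; last exact: ns_vert_distinct.
by move=> i j _; apply: ord_inj; have := ltn_ord i; have := ltn_ord j; lia.
Qed.

(* The vertices of a simplex are distinct, so the kernel of the surjection can be
   read off the vertices of the cell. *)
Lemma lvert_inj (S : NSSet n) (p : 'I_n.+1) (x y : Lcell (underlying S) p) :
  lvert x =1 lvert y -> x = y.
Proof.
case: x y => q [e s] [q' [e' s']]; rewrite /lvert /= => E.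
have ker i j : (e i == e j) = (e' i == e' j).
  by rewrite -(inj_eq (vert_distinct (s := s))) !E (inj_eq (vert_distinct (s := s'))).
have ee' := ordsurj_ker ker.
have qq' : q = q'.
  apply: val_inj; rewrite /= -[LHS](ordsurj_max e) -[RHS](ordsurj_max e').
  exact: ee'.
subst q'; have eE : e = e' by apply: ordsurj_eq => i; apply: val_inj; apply: ee'.
subst e'; suff -> : s = s' by [].
apply: (@ns_vert_inj n S); apply/ffunP => j.
by have [i <-] := os_surj e j.
Qed.

Lemma lvert0 (S : NSSet n) (x : Lcell (underlying S) ord0) :
  lvert x ord0 = vert (S := S) (projT2 x).2 ord0.
Proof.
case: x => q [e s]; rewrite /lvert /=.
by have [i <-] := os_surj e ord0; rewrite (ord1 i).
Qed.

Lemma lvert_unit (S : NSSet n) (p : 'I_n.+1) (s : cells S p) i :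
  lvert (L_unit (underlying S) p s) i = vert s i.
Proof. by []. Qed.

(** The [i]-th vertex is the restriction of [x] along a vertex inclusion, with which [g] commutes.
    Combined with [lvert_inj] it determines [g] from degree zero. *)
Lemma lvert_nat (S T : NSSet n) (g : Mor (hat S) (hat T)) (p : 'I_n.+1)
    (x : Lcell (underlying S) p) i :
  lvert ((g : NatTrans _ _) p x : Lcell (underlying T) p) i
  = degree_zero g (lvert x i).
Proof.
rewrite /degree_zero -lvert0.
have -> : L_unit (underlying S) ord0 (lvert x i)
    = Lact (vertex_map i : ordmap (@ord0 n) p) x.
  apply: lvert_inj => j; rewrite lvert_Lact lvert_unit (ord1 j).
  exact: vert0.
pose v : Mor (p : Op (DeltaPlus n)) ord0 := vertex_map i.
have E := f_equal (fun k => k x) (ntc_nat (g : NatTrans _ _) v).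
rewrite [RHS](f_equal (fun y : Lcell (underlying T) ord0 => lvert y ord0) E).
exact: esym (lvert_Lact (vertex_map i : ordmap (@ord0 n) p) _ _).
Qed.

Lemma mor_hat_eq (S T : NSSet n) (g g' : Mor (hat S) (hat T)) :
  degree_zero g =1 degree_zero g' -> g = g'.
Proof.
move=> E; apply: nattrans_eq => p; apply: functional_extensionality => x.
by apply: lvert_inj => i; rewrite !lvert_nat E.
Qed.

(** An element of [simp] carries its own proof of [p <= n], so it is compared with a cell through
    its vertices. *)
Lemma cell_simp (S : NSSet n) (p : 'I_n.+1) (c : cells S p) :
  exists s : simp S p, forall i, svert s i = vert c i.
Proof.
case: p c => p Hp c; have h : dim_ok n p := exist (fun _ : unit => (p <= n)%N) tt Hp.
move: c; rewrite (bool_irrelevance Hp (valP h)) => c.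
by exists (existT (fun h => cells S (dim_ord h) : Type) h c).
Qed.

Definition ordsurj_comp p q r (g : ordsurj q r) (f : ordsurj p q) : ordsurj p r.
Proof.
refine (@OrdSurj p r (ordmap_comp g f) _) => j.
by have [i <-] := os_surj g j; have [l <-] := os_surj f i; exists l.
Defined.

Lemma unbump_lt p (c : 'I_p.+1) (i : 'I_p.+2) : (unbump c i < p.+1)%N.
Proof.
by rewrite /unbump; have := ltn_ord i; have := ltn_ord c; case: ltnP => /=; lia.
Qed.

Lemma codegeneracy_homo p (c : 'I_p.+1) (i j : 'I_p.+2) : (i <= j)%N ->
  ((inord (unbump c i) : 'I_p.+1) <= (inord (unbump c j) : 'I_p.+1))%N.
Proof. by rewrite !inordK ?unbump_lt // /unbump; lia.
Qed.

Lemma codegeneracy_surj p (c : 'I_p.+1) j :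
  exists i, OrdMap (codegeneracy_homo c) i = j.
Proof.
have lt : (bump c j < p.+2)%N by rewrite /bump; have := ltn_ord j; lia.
by exists (Ordinal lt); rewrite /= bumpK inord_val.
Qed.

(** The surjection identifying [c] and [c + 1]. *)
Definition codegeneracy p (c : 'I_p.+1) : ordsurj p.+1 p := OrdSurj (codegeneracy_surj c).

End CompletedCells.

(** * Full faithfulness *)

Lemma dgahom_exterior_eq (k : fieldType) (A B : DGA k) (f g : DGAHom A B) :
  exterior A -> f 0 =1 g 0 -> f = g.
Proof.
move=> [E1 E2] fg0.
have fg1 a : f 1 a = g 1 a.
  have [N [u [v ->]]] := E1 a.
  rewrite (lin_sum (dgahom_lin f (p := 1))) (lin_sum (dgahom_lin g (p := 1))).
  apply: eq_bigr => i _; rewrite (dgahomM f (add0n 1)) (dgahomM g (add0n 1)).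
  by rewrite !dgahomd !fg0.
apply: dgahom_eq => p a; have [p0|p0] := posnP p.
  by subst p; apply: fg0.
have [N [u ->]] := E2 p p0 a.
rewrite (lin_sum (dgahom_lin f (p := p))) (lin_sum (dgahom_lin g (p := p))).
apply: eq_bigr => i _; rewrite !dgahom_wprod; congr (wprod _ p).
by apply: functional_extensionality => j; apply: fg1.
Qed.

Section FullyFaithful.
Variables (k : fieldType) (n : nat) (S T : NSSet n).

(** Test both pullbacks on [rho k t], where [t] is the image of [c] under [g]: the coefficient at
    [c] is 1 for [g], and for [g'] it is 1 only if [g'] has the same value. *)
Lemma Omega_faithful (g g' : Mor (hat S) (hat T)) :
  Omega_mor k g = Omega_mor k g' -> g = g'.
Proof.
move=> E; apply: mor_hat_eq => c.
have [s sc] := cell_simp c; have [t tc] := cell_simp (degree_zero g c).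
have [t' tc'] := cell_simp (degree_zero g' c).
have ev (h : Mor (hat S) (hat T)) u : svert u ord0 = degree_zero h c ->
    Om_pull h (rho k t) s = (u == t)%:R.
  move=> uE; rewrite (@Om_pull_match _ _ _ _ _ _ _ _ u) ?ffunE // => i.
  by rewrite sc (ord1 i) uE vert0.
have := f_equal (fun h : DGAHom (Omega_dga k T) (Omega_dga k S) => h 0 (rho k t) s) E.
rewrite /= (ev g t) ?tc ?vert0 // eqxx (ev g' t') ?tc' ?vert0 //.
case: eqP => [tt' _|_ /eqP]; last by rewrite oner_eq0.
by rewrite -[LHS]vert0 -tc -tt' tc' vert0.
Qed.

Variable h : DGAHom (Omega_dga k T) (Omega_dga k S).

(** Evaluation at [s] after [h] is a character of the function algebra. Its values [chi] on the
    primitive idempotents are orthogonal idempotents of a field with sum 1, so exactly one of them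
    is 1. *)
Lemma hom_deg0 : exists gam : simp S 0 -> simp T 0, forall b s, h 0 b s = b (gam s).
Proof.
suff /fin_all_exists[gam E] : forall s, exists t, forall b, h 0 b s = b t.
  by exists gam => b s; apply: E.
move=> s; pose chi t : k := h 0 (delta (vertex_iota k T) t) s.
have chiE b : h 0 b s = \sum_t b t * chi t.
  rewrite [in LHS](iota_expand (vertex_iota_iso k T) b : b = _).
  rewrite (lin_sum (dgahom_lin h (p := 0))) sum_ffunE; apply: eq_bigr => t _.
  by rewrite (linZ (dgahom_lin h (p := 0))) ffunE.
have chi1 : \sum_t chi t = 1.
  transitivity (h 0 (Om_one k T) s); last by rewrite (dgahom1 h) [LHS]Om_oneE.
  by rewrite chiE; apply: eq_bigr => t _; rewrite Om_oneE mul1r.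
have chiM t t' : chi t * chi t' = if t == t' then chi t else 0.
  have := f_equal (fun a : Om k T 0 => h 0 a s)
    (delta_mul (vertex_iota_iso k T) (addn0 0) t t').
  rewrite /= (dgahomM h (addn0 0)) [X in X = _ -> _]Om_wedgeE.
  have -> : restr (front (leq_addr_eq (addn0 0))) s = s.
    by apply: eq_vtx0; rewrite vtx_restr; congr (vtx s _); apply: val_inj.
  have -> : restr (back (leq_addl_eq (addn0 0))) s = s.
    by apply: eq_vtx0; rewrite vtx_restr; congr (vtx s _); apply: val_inj.
  rewrite -/(chi t) -/(chi t') => ->; case: eqP => // _.
  by rewrite (lin0 (dgahom_lin h (p := 0))) ffunE.
have [t nz] : exists t, chi t != 0.
  apply/existsP; apply: contraT; rewrite negb_exists => /forallP all0.
  move/eqP: chi1; rewrite big1 => [|t _].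
    by rewrite eq_sym oner_eq0.
  by apply/eqP; move: (all0 t); rewrite negbK.
have chit : chi t = 1 by apply: (mulfI nz); rewrite chiM eqxx mulr1.
exists t => b; rewrite chiE (bigD1 t) //= chit mulr1 big1 ?addr0 // => t' t't.
have := chiM t t'; rewrite chit mul1r eq_sym (negPf t't) => ->.
by rewrite mulr0.
Qed.

(** If no two consecutive vertices have equal images, the product of the image tuple takes the value
    1 at [s] under [h], so it is non-zero and the tuple is a simplex. Otherwise induct on the face
    omitting the first vertex of an equal pair. *)
Lemma lift_simplex (gam : simp S 0 -> simp T 0) :
  (forall b s, h 0 b s = b (gam s)) ->
  forall p (s : simp S p), exists q (e : ordsurj p q) (t : simp T q),
    forall i, vtx t (e i) = gam (vtx s i).
Proof.
move=> h_gam.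
have no_repeat p (s : simp S p) :
    (forall i, (i < p)%N -> gam (vtx s (inord i)) != gam (vtx s (inord i.+1))) ->
    exists q (e : ordsurj p q) (t : simp T q), forall i, vtx t (e i) = gam (vtx s i).
  move=> ne; pose v := [ffun i => gam (vtx s i)].
  have [|t tv] := @tprod_Omega_neq0 k n T p v.
    have vE i : v (inord i) = gam (vtx s (inord i)) by rewrite ffunE.
    apply: contra_neq (oner_neq0 k) => v0.
    have := hom_pprod h_gam (w := fun i => v (inord i)) (p := p) s.
    rewrite -/(tprod _ v) v0 (lin0 (dgahom_lin h (p := p))) ffunE => -> => [|i ip].
      suff -> : [forall i : 'I_p.+1, gam (vtx s i) == v (inord i)] by [].
      by apply/forallP => i; rewrite inord_val [v i]ffunE.
    by rewrite !vE ne.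
  by exists p, (ordsurj_id p), t => i; rewrite tv ffunE.
elim=> [|p IH] s; first exact: no_repeat.
case: (boolP [exists c : 'I_p.+1,
  gam (vtx s (inord c)) == gam (vtx s (inord c.+1))]); last first.
  rewrite negb_exists => /forallP ne; apply: no_repeat => i ip.
  exact: (ne (Ordinal ip)).
move=> /existsP[c /eqP E]; have cp := ltn_ord c.
have [q [e [t et]]] := IH (face (inord c) s).
exists q, (ordsurj_comp e (codegeneracy c)), t => i.
rewrite [LHS]et /face vtx_restr.
(* The degeneracy followed by the coface fixes every index except [c], which moves to [c + 1]; by
   [E] these two vertices have the same image. *)
have bE : bump (inord c : 'I_p.+2) (codegeneracy c i) = ((i == c :> nat) + i)%N.
  by rewrite [codegeneracy c i]/= !inordK ?unbump_lt ?unbumpKcond // ltnW.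
have [ic|ic] := eqVneq (i : nat) c.
  transitivity (gam (vtx s (inord c.+1))); last first.
    by rewrite -E; congr (gam (vtx s _)); apply: val_inj; rewrite /= inordK // ltnW.
  congr (gam (vtx s _)); apply: val_inj.
  by rewrite [LHS]bE ic eqxx add1n /= inordK.
by congr (gam (vtx s _)); apply: val_inj; rewrite [LHS]bE (negPf ic).
Qed.

(** Each image cell is chosen with the prescribed vertices. Naturality then holds because cells are
    determined by their vertices, and agreement with [h] need only be tested in degree 0. *)
Lemma Omega_full : exists g : Mor (hat S) (hat T), Omega_mor k g = h.
Proof.
have [gam h_gam] := hom_deg0.
(* Identifies [cells S ord0], where [degree_zero] lives, with [simp S 0], where [gam] lives. *)
have [sg sgE] : exists sg : cells S ord0 -> simp S 0, forall c, svert (sg c) ord0 = c.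
  apply: (@fin_all_exists _ (fun=> simp S 0) (fun c s => svert s ord0 = c)) => c.
  have [s sc] := cell_simp c.
  by exists s; rewrite sc vert0.
pose g0 c := svert (gam (sg c)) ord0.
have g0E s : g0 (svert s ord0) = svert (gam s) ord0.
  rewrite /g0; congr (svert (gam _) _); apply: simp_eq => i.
  by rewrite (ord1 i) sgE.
have lift (p : 'I_n.+1) (x : Lcell (underlying S) p) :
    exists y : Lcell (underlying T) p, forall i, lvert y i = g0 (lvert x i).
  case: x => r [pi c]; have [s sc] := cell_simp (c : cells S r).
  have [q [e [t et]]] := lift_simplex h_gam s.
  case: t et => hq t et.
  exists (@lcell n (underlying T) p (dim_ord hq) (ordsurj_comp e pi) t) => i.
  rewrite /lvert /= -sc.
  rewrite -(svert_vtx s (pi i) ord0) g0E -et.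
  exact: esym (svert_vtx (existT (fun h => cells T (dim_ord h) : Type) hq t) _ _).
pose gmap (p : 'I_n.+1) x := sval (constructive_indefinite_description _ (lift p x)).
have gmapE p x i : lvert (gmap p x) i = g0 (lvert x i).
  exact: (svalP (constructive_indefinite_description _ (lift p x)) i).
have nat (p q : Op (DeltaPlus n)) (f : Mor p q) :
    gmap q \o fmap (hat S) f = fmap (hat T) f \o gmap p.
  apply: functional_extensionality => x; apply: lvert_inj => i /=.
  by rewrite gmapE !lvert_Lact gmapE.
pose g : Mor (hat S) (hat T) := @MkNatTrans _ _ (hat S) (hat T) gmap nat.
exists g; apply: dgahom_exterior_eq; first exact: Omega_exterior.
move=> b; apply/ffunP => s; rewrite h_gam; apply: Om_pull_match => i.
rewrite (ord1 i) -g0E.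
have := lvert_nat g (L_unit (underlying S) ord0 (svert s ord0)) ord0.
by rewrite /= gmapE !lvert_unit vert0 => <-.
Qed.

End FullyFaithful.

Theorem theorem1 (k : fieldType) (char_k : 2%N \notin [pchar k]%R) (n : nat) :
  (forall A : DG k n, ess_image (Omega k n) A <-> in_DGhat A)
  /\ (exists Omega_in_DGhat : forall S : Op (SSnsHat n), in_DGhat (Omega k n S),
        is_equivalence
          (corestrict Omega_in_DGhat : Functor (Op (SSnsHat n)) (DGhat k n))).
Proof.
have ess (A : DG k n) : in_DGhat A -> ess_image (Omega k n) A.
  case: A => A An [X [iota [[A1 A2] A3 A4]]].
  exists (tuple_complex A1 A2 A3 A4 An); exists (realization A1 A2 A3 A4 An).
  exact: realization_iso.
split.
  move=> A; split; last exact: ess.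
  (* The conditions hold for the cochain algebra of [S] and are transported along the isomorphism
     [f]. *)
  case=> S [f [g [gf fg]]].
  have [X [iota H]] := Omega_in_DGhat k S.
  have fK p : cancel ((f : DGAHom _ _) p) ((g : DGAHom _ _) p).
    by move=> a; apply: (f_equal (fun h : DGAHom _ _ => h p a) gf).
  have gK p : cancel ((g : DGAHom _ _) p) ((f : DGAHom _ _) p).
    by move=> a; apply: (f_equal (fun h : DGAHom _ _ => h p a) fg).
  by exists X; eexists; apply: (in_DGhat_transport fK gK H).
exists (Omega_in_DGhat k (n := n)); apply: full_faithful_equivalence.
- by move=> S T g g'; apply: Omega_faithful.
- by move=> S T h; apply: Omega_full.
move=> [A HA]; have [S [f [g fg]]] := ess A HA.
by exists S, f, g.
Qed.
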